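(* Let $\Pi=(\Pi_n)_{n\ge1}$ be an exchangeable random partition of $\mathbb{N}$ with EPPF $\mathfrak{q}$, let $(Z_n)_{n\ge1}$ be i.i.d. random variables with law $H$ on a Polish space $\mathbb{X}$, independent of $\Pi$, and let $\tilde\Pi=(\tilde\Pi_n)_{n\ge1}$ be the random partition induced by the sequence $\xi_n=Z_{\mathscr{C}_n(\Pi)}$, $n\ge1$ (which is a $gSSS(\mathfrak{q},H)$). Let $\mathbb{X}_0=\{\bar x_1,\bar x_2,\dots\}$ be the set of atoms of $H$, $\bar a_j=H(\{\bar x_j\})$, $a=H(\mathbb{X}_0)>0$, $a_j=\bar a_j/a$, and for $x>0$ let $\alpha(x)=\#\{j:a_j\ge1/x\}$. Assume that there is a strictly positive random variable $S$ such that $|\Pi_n|/c_n\to S$ a.s. with $c_n=n^\sigma\ell(n)$, where $0<\sigma<1$ and $\ell$ is a deterministic slowly varying function at $+\infty$, and that $\alpha(x)=x^{\sigma_0}\ell_0^*(x)$, where $0\le\sigma_0\le1$ and $\ell_0^*$ is a slowly varying function at $+\infty$ (with $\lim_{x\to+\infty}\ell_0^*(x)=+\infty$ if $\sigma_0=0$). If $a<1$, then for every $r\ge1$ $$\frac{\mathcal{K}_r(\tilde\Pi_n)}{n^\sigma\ell(n)}\to(1-a)\,S\,\frac{\sigma\,\Gamma(r-\sigma)}{\Gamma(1-\sigma)\,r!}\quad\text{a.s.},$$ where $\mathcal{K}_r(\tilde\Pi_n)$ is the number of blocks of $\tilde\Pi_n$ with exactly $r$ elements.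
   Context: A random partition of $\mathbb{N}$ is a sequence $\Pi=(\Pi_n)_{n\ge1}$ of random partitions of $[n]=\{1,\dots,n\}$ consistent under restriction, with blocks $\Pi_{1,n},\Pi_{2,n},\dots$ listed in increasing order of smallest elements; $|\Pi_n|$ is the number of blocks. It is exchangeable if the law of each $\Pi_n$ is invariant under permutations of $[n]$; its EPPF is the symmetric function $\mathfrak{q}$ with $P\{\Pi_n=\pi_n\}=\mathfrak{q}(|\pi_{1,n}|,\dots,|\pi_{k,n}|)$ for each partition $\pi_n$ of $[n]$ with $k$ blocks. $\mathscr{C}_n(\Pi)=c$ if $n\in\Pi_{c,n}$. The random partition induced by $(\xi_n)$ is given by $i\sim j$ iff $\xi_i=\xi_j$. A $gSSS(\mathfrak{q},H)$ is a sequence conditionally i.i.d. given a random probability measure of the form $\sum_jp_j\delta_{Y_j}$ with $(Y_j)$ i.i.d. from $H$, independent of weights $(p_j)$ in $[0,1]$ with $\sum_jp_j=1$ a.s. whose decreasing rearrangement corresponds to $\mathfrak{q}$ via Kingman's correspondence. Standing assumption: the a.s. limits $p_j^\downarrow$ of (the $j$-th largest block size of $\Pi_n$)$/n$ satisfy $\sum_jp_j^\downarrow=1$ a.s. *)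

(* Defs.v *)
From HB Require Import structures.
From mathcomp Require Import all_boot all_order all_fingroup all_algebra.

Set Implicit Arguments.
Unset Strict Implicit.
Unset Printing Implicit Defensive.

Local Open Scope nat_scope.

(* Indices are shifted by one: the integer i of [n] = {1, ..., n} is the element
   of value i - 1 of 'I_n, the c-th block has index c - 1 in [blocks], and a
   sequence (x_i)_{i >= 1} is a function of i - 1 : nat. *)

Section Partitions.
Variable n : nat.
Implicit Types (B : {set 'I_n}) (p : {set {set 'I_n}}).

Definition is_partition p : bool := partition p [set: 'I_n].

Definition block_min B : nat := \big[minn/n]_(i in B) nat_of_ord i.

(* blocks in increasing order of their smallest elements *)
Definition blocks p : seq {set 'I_n} :=
  sort (fun B C => block_min B <= block_min C) (enum p).

Definition block_sizes p : seq nat := [seq #|B| | B : {set 'I_n} <- blocks p].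

Definition ranked_sizes p : seq nat := sort geq (block_sizes p).

Definition block_index p (i : 'I_n) : nat :=
  find (fun B : {set 'I_n} => i \in B) (blocks p).

Definition num_blocks_of_size (r : nat) p : nat :=
  #|[set B in p | #|B| == r]|.

Definition perm_partition (s : {perm 'I_n}) p : {set {set 'I_n}} :=
  [set (s @: B) | B : {set 'I_n} in p].

Definition induced_partition (T : eqType) (x : nat -> T) : {set {set 'I_n}} :=
  preim_partition (fun i : 'I_n => x i) [set: 'I_n].

End Partitions.

Definition restrict_partition (m n : nat) (le_mn : m <= n)
    (p : {set {set 'I_n}}) : {set {set 'I_m}} :=
  ([set (widen_ord le_mn @^-1: B) | B : {set 'I_n} in p] :\ set0).

From mathcomp Require Import finmap all_classical all_reals all_analysis.
Import Order.TTheory GRing.Theory Num.Theory.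
Import numFieldTopology.Exports numFieldNormedType.Exports.

Local Open Scope classical_set_scope.
Local Open Scope ring_scope.

Section RandomPartitions.
Context {d : measure_display} {Omega : measurableType d} {R : realType}.
Variable P : probability Omega R.
Implicit Types (Pi : forall n : nat, Omega -> {set {set 'I_n}}).

Definition random_partition Pi : Prop :=
  [/\ forall n w, is_partition (Pi n w),
      forall m n (le_mn : (m <= n)%N) w,
        restrict_partition le_mn (Pi n w) = Pi m w
    & forall n (p : {set {set 'I_n}}), measurable [set w | Pi n w = p]].

Definition exchangeable Pi : Prop :=
  forall n (s : {perm 'I_n}) (p : {set {set 'I_n}}),
    P [set w | Pi n w = perm_partition s p] = P [set w | Pi n w = p].

Definition is_EPPF Pi (q : seq nat -> R) : Prop :=
  (forall s t : seq nat, 0%N \notin s -> perm_eq s t -> q s = q t) /\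
  (forall n (p : {set {set 'I_n}}), (0 < n)%N -> is_partition p ->
    P [set w | Pi n w = p] = (q (block_sizes p))%:E).

(* the almost sure limits f_j of (j-th largest block size of Pi_n) / n sum to 1 *)
Definition proper_frequencies Pi : Prop :=
  exists f : nat -> Omega -> R,
    (forall j, {ae P, forall w,
       (nth 0%N (ranked_sizes (Pi n w)) j)%:R / n%:R @[n --> \oo] --> f j w}) /\
    {ae P, forall w, series (fun j => f j w) @ \oo --> (1 : R)}.

Definition mutually_independent d' (T : measurableType d')
    (Z : nat -> {RV P >-> T}) : Prop :=
  forall (s : seq nat) (A : nat -> set T), uniq s ->
    (forall i, measurable (A i)) ->
    P (\bigcap_(i in [set` s]) (Z i @^-1` A i)) =
      (\prod_(i <- s) P (Z i @^-1` A i))%E.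

Definition sigma_of_partition Pi : set (set Omega) :=
  <<s [set E | exists n (p : {set {set 'I_n}}), E = [set w | Pi n w = p]] >>.

Definition sigma_of_sequence d' (T : measurableType d')
    (Z : nat -> {RV P >-> T}) : set (set Omega) :=
  <<s [set E | exists n (A : set T), measurable A /\ E = Z n @^-1` A] >>.

Definition independent_sigma (F G : set (set Omega)) : Prop :=
  forall A B, F A -> G B -> P (A `&` B) = (P A * P B)%E.

End RandomPartitions.

(* the sequence xi_n = Z_{C_n(Pi)}, where C_n(Pi) is the index of the block of
   Pi_n containing n *)
Definition labelled_sequence (Omega T : Type)
    (Pi : forall n : nat, Omega -> {set {set 'I_n}}) (Z : nat -> Omega -> T)
    (w : Omega) (n : nat) : T :=
  Z (block_index (Pi n.+1 w) ord_max) w.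

Definition polish (R : realType) (X : topologicalType) : Prop :=
  (exists2 D : set X, countable D & dense D) /\
  exists dist : X -> X -> R,
    [/\ forall x y, dist x y = 0 <-> x = y,
        forall x y, dist x y = dist y x,
        forall x y z, dist x z <= dist x y + dist y z,
        forall (x : X) (A : set X), nbhs x A <->
          exists2 e : R, 0 < e & [set y | dist x y < e] `<=` A
      & forall u : nat -> X,
          (forall e : R, 0 < e -> exists N, forall m n,
             (N <= m)%N -> (N <= n)%N -> dist (u m) (u n) < e) ->
          exists x : X, u @ \oo --> x].

Notation borel X := (g_sigma_algebraType (@open X)).

Section Atoms.
Context {R : realType} {X : ptopologicalType}.
Variable H : probability (borel X) R.

Definition atoms : set (borel X) := [set x | (0 < H [set x])%E].

Definition atomic_mass : R := fine (H atoms).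

(* alpha(x) = #{j : a_j >= 1/x}; the set is finite as the a_j sum to 1 *)
Definition atom_count (x : R) : nat :=
  #|` fset_set [set y | atoms y /\ (1 / x <= fine (H [set y]) / atomic_mass)%R]|%N.

End Atoms.

(* positive and measurable on a neighbourhood of +oo; no condition near 0, where
   alpha(x) = x^sigma0 l0(x) vanishes (alpha(x) = 0 for x < 1) *)
Definition slowly_varying (R : realType) (l : R -> R) : Prop :=
  (exists2 A : R, measurable_fun `[A, +oo[ l & forall x, A <= x -> 0 < l x) /\
  forall t : R, 0 < t -> l (t * x) / l x @[x --> +oo] --> (1 : R).

Definition Gamma (R : realType) (x : R) : R :=
  \int[lebesgue_measure]_(t in `]0, +oo[) (t `^ (x - 1) * expR (- t)).

(* Main.v *)
Require Import Defs.
From HB Require Import structures.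
From mathcomp Require Import all_boot all_order all_fingroup all_algebra.
From mathcomp Require Import zify ring lra.

Set Implicit Arguments.
Unset Strict Implicit.
Unset Printing Implicit Defensive.

Import Order.TTheory GRing.Theory Num.Theory.

(** Merging the blocks of Pi that carry equal labels gives a partition that is
    again exchangeable ([induced_labelled_exchangeable]): its law is a mixture,
    over the values of Pi, of laws of partitions induced by i.i.d. labels, and
    such a law depends only on which elements share a label.  Its number of
    blocks is asymptotically (1 - a) |Pi_n| ([distinct_values_ratio]).  Indeed
    it is the number of distinct values among the first |Pi_n| labels; labels
    that are not atoms of H are almost surely distinct and have frequency 1 - a,
    while the labels outside a suitable finite set of atoms have a frequency
    close to 1 - a.  The theorem thus becomes a statement about one exchangeable
    partition ([exchangeable_block_size_ratio]): if its number of blocks K_n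
    varies regularly with exponent sigma, then the proportion of its blocks with
    r elements tends to the coefficient p_r of s^r in 1 - (1 - s)^sigma, which
    is the constant of the theorem ([Gamma_binom_coef]).

    That statement is proved by sampling.  Given the block sizes of the
    partition of [bm], exchangeability makes the last m elements a uniform
    random subset.  It contains a given block of size r with probability close
    to b^-r, and these events are negatively correlated, so that the number of
    blocks contained in it is within o(K_{bm}) of its mean
    ([captured_variance]).  On the other hand these blocks are those whose
    first element is among the last m, and there are K_{bm} - K_{(b-1)m} of
    them.  Dividing by K_{bm}, the generating function of the empirical law of
    the block sizes, taken at s = 1/b, tends to 1 - (1 - 1/b)^sigma for every b;
    letting b grow identifies the limits of the coefficients one after the other
    ([pgf_inversion]).

    Almost sure statements are obtained along m = j^q, where q is so large that
    K_{b j^q} grows at least like j^2 ([regular_growth]) and the probabilities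
    of deviation are summable.  They extend to all n because the quantities
    involved are monotone in n ([squeeze_subsequence]). *)

(** * Capturing blocks by a uniform random set *)

Local Open Scope ring_scope.

Section Capture.
Variables (R : realFieldType) (N : nat) (C : {set 'I_N}).
Implicit Types (A B : {set 'I_N}) (p : {set {set 'I_N}}) (s : {perm 'I_N}).

Definition capture_count B : nat := #|[set s : {perm 'I_N} | s @: B \subset C]|.

(** Probability that a uniform c-subset of an m-set contains r given elements.
    With truncated subtraction the factor i = c vanishes, so that the value is 0
    as soon as c < r. *)
Definition capture_prob (c m r : nat) : R :=
  \prod_(i < r) ((c - i)%N%:R / (m - i)%N%:R).

Lemma capture_count_swap B x y : x \notin B -> y \notin B ->
  (capture_count (x |: B) <= capture_count (y |: B))%N.
Proof.
move=> xB yB; rewrite /capture_count.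
rewrite -(card_imset _ (@mulgI _ (tperm x y))); apply: subset_leq_card.
apply/subsetP => _ /imsetP[s + ->]; rewrite !inE => sC.
apply/subsetP => _ /imsetP[z zB ->]; rewrite permM.
apply: (subsetP sC); apply: imset_f; move: zB; rewrite !inE.
case: tpermP => [->|-> _|/eqP zx /eqP zy]; rewrite ?eqxx //.
- by rewrite (negbTE xB) orbF eq_sym => ->.
- by rewrite (negbTE zy) /= => ->; rewrite orbT.
Qed.

(** Count the pairs of a permutation s mapping B into C and a point y outside B
    with s y in C.  All the points y contribute equally, by composition with a
    transposition, and a given s has #|C| - #|B| of them. *)
Lemma capture_count_rec B x : x \notin B ->
  ((N - #|B|) * capture_count (x |: B) = (#|C| - #|B|) * capture_count B)%N.
Proof.
move=> xB.
have ->: ((N - #|B|) * capture_count (x |: B) =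
   \sum_(y in ~: B) capture_count (y |: B))%N.
  rewrite (eq_bigr (fun=> capture_count (x |: B))); last first.
    move=> y; rewrite inE => yB; apply/eqP.
    by rewrite eqn_leq !capture_count_swap.
  by rewrite sum_nat_const (cardsCs (~: B)) setCK card_ord.
rewrite (eq_bigr (fun y => \sum_(s : {perm 'I_N} | s @: B \subset C) (s y \in C : nat))%N); last first.
  move=> y _; rewrite /capture_count -sum1dep_card [RHS]big_mkcond /= [LHS]big_mkcond /=.
  apply: eq_bigr => s _; rewrite imsetU1 subUset sub1set.
  by case: (s y \in C); case: (s @: B \subset C).
rewrite exchange_big /= (eq_bigr (fun=> #|C| - #|B|)%N); last first.
  move=> s sBC; rewrite -big_mkcondr /= sum1dep_card.
  have -> : [set y in ~: B | s y \in C] = (s @^-1: C) :\: B.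
    by apply/setP => y; rewrite !inE.
  rewrite cardsD (setIidPr _); last first.
    by apply/subsetP => y yB; rewrite inE (subsetP sBC) ?imset_f.
  by rewrite (card_preimset _ (@perm_inj _ s)).
by rewrite sum_nat_const mulnC /capture_count cardsE.
Qed.

Lemma capture_countE B :
  (capture_count B)%:R = (N`!)%:R * capture_prob #|C| N #|B| :> R.
Proof.
have [k] := ubnPeq #|B|; elim: k B => [|k IH] B.
  rewrite cards_eq0 => /eqP ->; rewrite /capture_prob big_ord0 mulr1.
  rewrite /capture_count (_ : [set _ | _] = setT) ?cardsT ?card_Sn //; apply/setP => s.
  by rewrite !inE imset0 sub0set.
move=> /eqP Bk; have /card_gt0P[x xB] : (0 < #|B|)%N by rewrite Bk.
have D1 : #|B :\ x| = k by have := cardsD1 x B; rewrite xB Bk add1n => -[].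
have := @capture_count_rec (B :\ x) x; rewrite setD1K// D1 !inE eqxx => /(_ isT).
move=> /(congr1 (fun n => n%:R : R)); rewrite !natrM (IH (B :\ x)) ?D1 // => E.
have Nk : (N - k)%N%:R != 0 :> R.
  rewrite pnatr_eq0 subn_eq0 -ltnNge -Bk -[X in (_ <= X)%N](card_ord N).
  exact: max_card.
rewrite /capture_prob big_ord_recr /= -/(capture_prob _ _ _).
by apply: (mulfI Nk); rewrite E /capture_prob; field.
Qed.

Lemma capture_prob_ge0 c m r : 0 <= capture_prob c m r.
Proof. by apply: prodr_ge0 => i _; rewrite divr_ge0. Qed.

Lemma capture_ratio_decr c m i : (c <= m)%N ->
  (c - i.+1)%N%:R / (m - i.+1)%N%:R <= (c - i)%N%:R / (m - i)%N%:R :> R.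
Proof.
move=> cm; have [mi|im] := leqP m i.+1.
  by rewrite (_ : m - i.+1 = 0)%N ?invr0 ?mulr0 ?divr_ge0//; lia.
rewrite ler_pdivrMr ?ltr0n ?subn_gt0// mulrAC ler_pdivlMr ?ltr0n ?subn_gt0 1?ltnW//.
by rewrite -!natrM ler_nat; nia.
Qed.

(** Captures of disjoint sets are negatively correlated: the factor
    (c - i) / (m - i) is nonincreasing in i, so that the r2 factors following the
    first r1 ones are smaller than the first r2 ones. *)
Lemma capture_prob_addn c m r1 r2 : (c <= m)%N ->
  capture_prob c m (r1 + r2) <= capture_prob c m r1 * capture_prob c m r2.
Proof.
move=> cm; rewrite {1}/capture_prob big_split_ord /=.
apply: ler_wpM2l; first exact: capture_prob_ge0.
apply: ler_prod => i _; rewrite divr_ge0//=.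
elim: r1 => //= k IH; apply: le_trans IH; rewrite addSn.
exact: capture_ratio_decr.
Qed.

Definition captured p : nat := #|[set B in p | B \subset C]|.

Definition mean_captured p : R := \sum_(B in p) capture_prob #|C| N #|B|.

Lemma perm_imset_inj s : injective (fun B => s @: B).
Proof. exact: imset_inj (@perm_inj _ s). Qed.

Lemma perm_partition_bij s : bijective (@perm_partition N s).
Proof. by apply: injF_bij; apply: imset_inj; exact: perm_imset_inj. Qed.

Lemma card_perm_partition s p : #|perm_partition s p| = #|p|.
Proof. by rewrite card_imset //; exact: perm_imset_inj. Qed.

Lemma mean_captured_perm s p : mean_captured (perm_partition s p) = mean_captured p.
Proof.
rewrite /mean_captured big_imset /=; last by move=> A B _ _; exact: perm_imset_inj.
by apply: eq_bigr => B _; rewrite (card_imset _ (@perm_inj _ s)).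
Qed.

Lemma captured_perm s p :
  captured (perm_partition s p) = (\sum_(B in p) (s @: B \subset C))%N.
Proof.
rewrite /captured -sum1dep_card big_mkcondr /= big_imset /=; last first.
  by move=> A B _ _; exact: perm_imset_inj.
by apply: eq_bigr => B _; case: ifP.
Qed.

(** Distinct blocks are disjoint, so that their capture indicators have a
    nonpositive covariance, and each block contributes at most 1 to the
    variance. *)
Lemma captured_variance p : is_partition p ->
  \sum_(s : {perm 'I_N}) ((captured (perm_partition s p))%:R - mean_captured p) ^+ 2
    <= (N`!)%:R * #|p|%:R :> R.
Proof.
move=> pp.
have cN : (#|C| <= N)%N by rewrite -[X in (_ <= X)%N]card_ord max_card.
pose P B : R := capture_prob #|C| N #|B|.
have sumC B : \sum_(s : {perm 'I_N}) (s @: B \subset C)%:R = (N`!)%:R * P B.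
  rewrite -capture_countE /capture_count -sum1dep_card natr_sum [RHS]big_mkcond /=.
  by apply: eq_bigr => s _; case: ifP.
have sum1 : \sum_(s : {perm 'I_N}) 1 = (N`!)%:R :> R.
  by rewrite sumr_const -card_Sn.
have -> : \sum_(s : {perm 'I_N}) ((captured (perm_partition s p))%:R - mean_captured p) ^+ 2
  = \sum_(B in p) \sum_(B' in p) \sum_(s : {perm 'I_N})
     ((s @: B \subset C)%:R - P B) * ((s @: B' \subset C)%:R - P B').
  under [RHS]eq_bigr do rewrite exchange_big /=.
  rewrite [RHS]exchange_big /=; apply: eq_bigr => s _.
  rewrite captured_perm natr_sum -sumrB expr2 mulr_suml.
  by apply: eq_bigr => B _; rewrite mulr_sumr.
have covE B B' : \sum_(s : {perm 'I_N})
     ((s @: B \subset C)%:R - P B) * ((s @: B' \subset C)%:R - P B')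
   = (\sum_(s : {perm 'I_N}) ((s @: B \subset C) && (s @: B' \subset C))%:R)
     - (N`!)%:R * (P B * P B').
  rewrite (eq_bigr (fun s : {perm 'I_N} => ((s @: B \subset C) && (s @: B' \subset C))%:R
     - P B' * (s @: B \subset C)%:R - P B * (s @: B' \subset C)%:R + P B * P B' * 1));
    last by move=> s _; rewrite -mulnb natrM; ring.
  rewrite big_split /= !sumrB -!mulr_sumr sum1 !sumC; ring.
rewrite mulr_natr -sumr_const; apply: ler_sum => B Bp.
rewrite (bigD1 B) //= -[leRHS]addr0; apply: lerD.
  rewrite covE (eq_bigr (fun s : {perm 'I_N} => (s @: B \subset C)%:R)); last first.
    by move=> s _; rewrite andbb.
  rewrite sumC -mulrBr -[leRHS]mulr1; apply: ler_wpM2l => //.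
  by have := sqr_ge0 (P B - 1 / 2%:R); nra.
rewrite sumr_le0// => B' /andP[B'p B'B]; rewrite covE.
have BB' : [disjoint B & B'].
  case/and3P: pp => _ /trivIsetP tI _.
  by apply: tI => //; rewrite eq_sym.
rewrite (eq_bigr (fun s : {perm 'I_N} => (s @: (B :|: B') \subset C)%:R)); last first.
  by move=> s _; rewrite imsetU subUset.
rewrite sumC -mulrBr mulr_ge0_le0// subr_le0 /P (_ : #|B :|: B'| = #|B| + #|B'|)%N.
  exact: capture_prob_addn.
by apply/eqP; rewrite (leq_card_setU B B').2.
Qed.

Lemma captured_chebyshev (e : R) p : 0 < e -> (0 < N)%N -> is_partition p ->
  #|[set s : {perm 'I_N} | e * #|perm_partition s p|%:R <
       `|(captured (perm_partition s p))%:R - mean_captured (perm_partition s p)|]|%:R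
   <= (N`!)%:R / (e ^+ 2 * #|p|%:R) :> R.
Proof.
move=> e0 N0 pp.
have p0 : 0 < #|p|%:R :> R.
  rewrite ltr0n; apply/card_gt0P; exists (pblock p (Ordinal N0)).
  by apply: pblock_mem; case/and3P: pp => /eqP -> _ _; rewrite inE.
have ep0 : 0 < (e * #|p|%:R) ^+ 2 by rewrite exprn_gt0// mulr_gt0.
have -> : (N`!)%:R / (e ^+ 2 * #|p|%:R) = (N`!)%:R * #|p|%:R / (e * #|p|%:R) ^+ 2 :> R.
  by field; rewrite !gt_eqF.
rewrite ler_pdivlMr//; apply: le_trans (captured_variance pp).
rewrite -sum1dep_card natr_sum mulr_suml big_mkcond /=; apply: ler_sum => s _.
rewrite card_perm_partition mean_captured_perm.
case: ifP => [h|_]; last exact: sqr_ge0.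
rewrite mul1r -[leRHS]real_normK ?num_real// lerXn2r ?nnegrE//; last exact: ltW.
by rewrite mulr_ge0// ltW.
Qed.
End Capture.

(** * Partitions induced by a sequence *)

Section InducedPartition.
Variables (T : eqType) (x : nat -> T).
Implicit Types (n m i j r : nat).

(** Marks the least elements of the blocks.  As this does not depend on n, sums
    over the blocks of the partitions of different sets [n] can be compared term
    by term. *)
Definition new_value i : bool := x i \notin [seq x j | j <- iota 0 i].

Definition value_class n i : {set 'I_n} := [set j : 'I_n | x j == x i].

Lemma new_valueP i : reflect (forall j, (j < i)%N -> x j != x i) (new_value i).
Proof.
apply: (iffP idP) => [h j ji|h].
  apply: contraNN h => /eqP <-; apply/mapP; exists j => //.
  by rewrite mem_iota.
apply/negP => /mapP[j]; rewrite mem_iota add0n => /andP[_ ji] e.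
by have := h j ji; rewrite e eqxx.
Qed.

Lemma new_value_inj i j : new_value i -> new_value j -> x i = x j -> i = j.
Proof.
move=> /new_valueP ni /new_valueP nj e; have [ij|ji|//] := ltngtP i j.
- by have := nj i ij; rewrite e eqxx.
- by have := ni j ji; rewrite e eqxx.
Qed.

Lemma induced_partition_is n : is_partition (induced_partition n x).
Proof. exact: preim_partitionP. Qed.

Lemma induced_partition_imset n :
  induced_partition n x = [set value_class n i | i : 'I_n & new_value i].
Proof.
apply/setP => B; apply/imsetP/imsetP => [[i _ ->]|[i _ ->]].
  have ex : exists j, x j == x i by exists i.
  pose k := ex_minn ex.
  have [xk kmin] : x k == x i /\ forall j, x j == x i -> (k <= j)%N.
    by rewrite /k; case: ex_minnP.
  have kn : (k < n)%N by apply: leq_ltn_trans (kmin i _) _.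
  exists (Ordinal kn); rewrite ?inE /=.
    apply/new_valueP => j jk; apply/negP => /eqP e.
    by have := kmin j; rewrite e => /(_ xk); rewrite leqNgt jk.
  by apply/setP => j; rewrite !inE /= (eqP xk) eq_sym.
exists i; rewrite ?inE //.
by apply/setP => j; rewrite !inE eq_sym.
Qed.

Lemma value_class_inj n :
  {in [pred i : 'I_n | new_value i] &, injective (fun i : 'I_n => value_class n i)}.
Proof.
move=> i j; rewrite !inE => ni nj e; apply: val_inj; apply: new_value_inj => //.
have : i \in value_class n j by rewrite -e inE.
by rewrite inE => /eqP.
Qed.

Lemma big_induced_partition (M : Type) (idx : M) (op : Monoid.com_law idx) n
    (F : {set 'I_n} -> M) :
  \big[op/idx]_(B in induced_partition n x) F B =
  \big[op/idx]_(i < n | new_value i) F (value_class n i).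
Proof.
rewrite induced_partition_imset big_imset /=.
  by apply: eq_bigl => i; rewrite inE.
by move=> i j; rewrite !inE => ni nj; apply: value_class_inj; rewrite inE.
Qed.

Lemma card_induced_partition n :
  #|induced_partition n x| = (\sum_(i < n) new_value i)%N.
Proof.
rewrite -sum1_card big_induced_partition [LHS]big_mkcond /=.
by apply: eq_bigr => i _; case: (new_value i).
Qed.

Lemma card_induced_partition_homo m n : (m <= n)%N ->
  (#|induced_partition m x| <= #|induced_partition n x|)%N.
Proof.
move=> mn; rewrite !card_induced_partition.
rewrite (big_ord_widen _ (fun i => new_value i : nat) mn).
by rewrite [leqLHS]big_mkcond /=; apply: leq_sum => i _; case: ifP.
Qed.

Lemma card_induced_partition_gt0 n : (0 < n)%N -> (0 < #|induced_partition n x|)%N.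
Proof.
case: n => // n _; rewrite card_induced_partition big_ord_recl.
by rewrite (_ : new_value _ = true) //; apply/new_valueP.
Qed.

Lemma card_induced_partition_natr_homo (R : numDomainType) :
  {homo (fun n => #|induced_partition n x|%:R : R) : m n / (m <= n)%N >-> m <= n}.
Proof. by move=> m n mn; rewrite ler_nat card_induced_partition_homo. Qed.

Lemma card_induced_partition_natr_ge1 (R : numDomainType) n : (0 < n)%N ->
  1 <= #|induced_partition n x|%:R :> R.
Proof. by move=> n0; rewrite ler1n card_induced_partition_gt0. Qed.

(** A block avoids the first n elements exactly when its value appears for the
    first time after them. *)
Lemma captured_induced n N : (n <= N)%N ->
  captured [set i : 'I_N | (n <= i)%N] (induced_partition N x) =
  (#|induced_partition N x| - #|induced_partition n x|)%N.
Proof.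
move=> nN; rewrite /captured -sum1dep_card big_mkcondr /= big_induced_partition.
rewrite !card_induced_partition (big_ord_widen _ (fun i => new_value i : nat) nN).
rewrite (bigID (fun i : 'I_N => (i < n)%N) _ (fun i : 'I_N => new_value i : nat)).
rewrite addKn [LHS]big_mkcond [RHS]big_mkcond /=; apply: eq_bigr => i _.
rewrite -leqNgt; case: ifP => ni; last by case: ifP.
congr (if _ then _ else _); apply/subsetP/idP => [/(_ i)|nle j].
  by rewrite !inE eqxx => /(_ isT).
rewrite !inE => /eqP e; apply: leq_trans nle _; rewrite leqNgt.
by apply/negP => ji; have /new_valueP /(_ j ji) := ni; rewrite e eqxx.
Qed.

Lemma card_value_class_homo m n i : (m <= n)%N ->
  (#|value_class m i| <= #|value_class n i|)%N.
Proof.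
move=> mn; rewrite -!sum1dep_card.
rewrite (big_ord_widen_cond _ (fun j => x j == x i) (fun=> 1%N) mn).
rewrite [leqLHS]big_mkcond [leqRHS]big_mkcond /=; apply: leq_sum => j _.
by case: (x j == x i) => //=; case: ifP.
Qed.

Lemma sum_induced_homo (R : numDomainType) (f : nat -> R) m n :
  {homo f : i j / (i <= j)%N >-> i <= j} -> (forall i, 0 <= f i) -> (m <= n)%N ->
  \sum_(B in induced_partition m x) f #|B| <=
  \sum_(B in induced_partition n x) f #|B|.
Proof.
move=> fh f0 mn; rewrite !big_induced_partition.
rewrite (big_ord_widen_cond _ new_value (fun i => f #|value_class m i|) mn).
rewrite [leLHS]big_mkcond [leRHS]big_mkcond /=; apply: ler_sum => i _.
case: (new_value i) => //=; case: ifP => // _.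
exact/fh/card_value_class_homo.
Qed.

Lemma sum_induced_by_size (R : pzRingType) (f : nat -> R) n :
  \sum_(B in induced_partition n x) f #|B| =
  \sum_(r < n.+1) (num_blocks_of_size r (induced_partition n x))%:R * f r.
Proof.
have cB (B : {set 'I_n}) : (#|B| < n.+1)%N.
  by rewrite ltnS -[X in (_ <= X)%N](card_ord n) max_card.
rewrite (partition_big (fun B => Ordinal (cB B)) xpredT) //=.
apply: eq_bigr => r _; rewrite /num_blocks_of_size -sum1dep_card natr_sum mulr_suml.
by apply: eq_bigr => B /andP[_ /eqP <-]; rewrite mul1r.
Qed.

End InducedPartition.

(** * Labels of the blocks of a consistent family of partitions *)

Local Open Scope nat_scope.

Lemma index_sorted (T : eqType) (key : T -> nat) (s : seq T) (x : T) :
  sorted (fun y z => key y <= key z) s -> {in s &, injective key} -> x \in s ->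
  index x s = count (fun y => key y < key x) s.
Proof.
have tr : transitive (fun y z => key y <= key z) by move=> ? ? ?; exact: leq_trans.
elim: s => //= y s IH; rewrite (path_sortedE tr) => /andP[/allP ys ss] kinj.
have {IH} IH := IH ss (sub_in2 (@mem_behead _ (y :: s)) kinj).
rewrite inE; case: eqVneq => [->|xy] /=.
  move=> _; rewrite ltnn add0n; apply/esym/eqP; rewrite -leqn0 leqNgt -has_count.
  by apply/hasPn => z /ys; rewrite -leqNgt.
move=> xs.
rewrite IH// [in RHS](_ : key y < key x) ?add1n// ltn_neqAle ys// andbT.
apply: contraNneq xy => kyx; apply/eqP/esym.
by apply: kinj => //; rewrite inE ?eqxx ?xs ?orbT.
Qed.

Section BlockIndex.
Variables (n : nat) (p : {set {set 'I_n}}).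
Hypothesis pp : is_partition p.
Implicit Types (B : {set 'I_n}) (i j : 'I_n).

Lemma block_min_le B i : i \in B -> block_min B <= i.
Proof.
rewrite /block_min -big_filter -minEnat => iB; rewrite big_filter.
exact: (@bigmin_le_cond _ _ _ _ _ (fun i => i \in B) (fun i : 'I_n => i : nat)).
Qed.

Lemma block_min_in B : B != set0 -> exists2 i, i \in B & block_min B = i.
Proof.
case/set0Pn => i iB; rewrite /block_min -minEnat.
have [//|j jB jE] := @eq_bigmin _ _ _ n i (mem B) (fun i : 'I_n => i : nat) iB.
  by move=> k _; exact: ltnW.
by exists j.
Qed.

Lemma partition_pblock B i : B \in p -> i \in B -> pblock p i = B.
Proof. by move=> Bp iB; apply: def_pblock => //; case/and3P: pp. Qed.

Lemma pblock_in i : (pblock p i \in p) /\ (i \in pblock p i).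
Proof.
have ic : i \in cover p by case/and3P: pp => /eqP -> _ _; rewrite inE.
by rewrite pblock_mem // mem_pblock.
Qed.

Lemma partition_nonempty B : B \in p -> B != set0.
Proof. by move=> Bp; apply: contraTneq Bp => ->; case/and3P: pp. Qed.

Lemma block_min_inj : {in p &, injective (@block_min n)}.
Proof.
move=> B B' Bp B'p e.
have [i iB ie] := block_min_in (partition_nonempty Bp).
have [j jB je] := block_min_in (partition_nonempty B'p).
have ij : i = j by apply: val_inj; rewrite /= -ie -je.
by rewrite -(partition_pblock Bp iB) -(partition_pblock B'p jB) ij.
Qed.

Lemma mem_blocks B : (B \in blocks p) = (B \in p).
Proof. by rewrite mem_sort mem_enum. Qed.

Lemma size_blocks : size (blocks p) = #|p|.
Proof. by rewrite size_sort -cardE. Qed.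

Lemma blocks_uniq : uniq (blocks p).
Proof. by rewrite sort_uniq enum_uniq. Qed.

Lemma block_index_index i : block_index p i = index (pblock p i) (blocks p).
Proof.
rewrite /block_index /index; apply: eq_in_find => B; rewrite mem_blocks => Bp /=.
have [_ ip] := pblock_in i.
by apply/idP/eqP => [iB|->//]; rewrite (partition_pblock Bp iB).
Qed.

Lemma block_index_lt i : block_index p i < #|p|.
Proof.
rewrite block_index_index -size_blocks index_mem mem_blocks.
by have [] := pblock_in i.
Qed.

Lemma block_index_onto k : k < #|p| -> exists i, block_index p i = k.
Proof.
rewrite -size_blocks => kp; pose B := nth set0 (blocks p) k.
have Bp : B \in p by rewrite -mem_blocks mem_nth.
have /set0Pn[i iB] := partition_nonempty Bp.
by exists i; rewrite block_index_index (partition_pblock Bp iB) index_uniq// blocks_uniq.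
Qed.

Lemma block_index_eq i j : (block_index p i == block_index p j) = (pblock p i == pblock p j).
Proof.
rewrite !block_index_index; apply/eqP/eqP => [e|->//].
have ip := (pblock_in i).1; have jp := (pblock_in j).1.
rewrite -mem_blocks in ip; rewrite -mem_blocks in jp.
by rewrite -(nth_index set0 ip) -(nth_index set0 jp) e.
Qed.

(** Unlike the position in a sorted list, this expression is visibly preserved
    by restriction: the blocks with a smaller minimum than the block of i survive
    the restriction to a set containing i, with the same minimum. *)
Lemma block_index_count i :
  block_index p i = #|[set B in p | block_min B < block_min (pblock p i)]|.
Proof.
rewrite block_index_index (@index_sorted _ (@block_min n)).
- rewrite /blocks (seq.permP (permEl (perm_sort _ _))).
  by rewrite -sum1_count big_enum_cond sum1dep_card.
- by apply: sort_sorted => B B'; exact: leq_total.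
- by move=> B B'; rewrite !mem_blocks; exact: block_min_inj.
by rewrite mem_blocks; have [] := pblock_in i.
Qed.

End BlockIndex.

Section ConsistentPartitions.
Variable pi : forall n, {set {set 'I_n}}.
Hypothesis pi_part : forall n, is_partition (pi n).
Hypothesis pi_restrict : forall m n (mn : m <= n),
  restrict_partition mn (pi n) = pi m.

(** The index read by [labelled_sequence]; by consistency it is the index of the
    block of i in every partition of the family that involves i. *)
Definition arrival_label (i : nat) : nat := block_index (pi i.+1) ord_max.

Section Restriction.
Variables (m n : nat) (mn : m <= n).
Let f := widen_ord mn.
Let res (B : {set 'I_n}) : {set 'I_m} := f @^-1: B.

Let block_min_restrict (B : {set 'I_n}) : res B != set0 -> block_min (res B) = block_min B.
Proof.
move=> rB; have [i] := block_min_in rB; rewrite inE => iB ie.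
have B0 : B != set0 by apply/set0Pn; exists (f i).
have [j jB je] := block_min_in B0; apply/eqP; rewrite eqn_leq.
have ji : j <= i by rewrite -je (block_min_le iB).
have jm : j < m by apply: leq_ltn_trans ji _.
have : Ordinal jm \in res B by rewrite inE (_ : f _ = j)//; exact: val_inj.
by move=> /block_min_le h; rewrite {1}je h/= ie (block_min_le iB).
Qed.

Lemma block_index_restrict (i : 'I_m) : block_index (pi n) (f i) = block_index (pi m) i.
Proof.
rewrite !block_index_count//.
have pb : pblock (pi m) i = res (pblock (pi n) (f i)).
  apply: partition_pblock => //; last by rewrite inE; have [] := pblock_in (pi_part n) (f i).
  rewrite -(pi_restrict mn) !inE; apply/andP; split.
    by apply/set0Pn; exists i; rewrite inE; have [] := pblock_in (pi_part n) (f i).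
  by apply: imset_f; have [] := pblock_in (pi_part n) (f i).
have rb0 : res (pblock (pi n) (f i)) != set0.
  by rewrite -pb; apply: partition_nonempty (pi_part m) _ _; have [] := pblock_in (pi_part m) i.
rewrite pb block_min_restrict//.
set x := block_min _.
have xm : x < m.
  by apply: leq_ltn_trans (_ : f i < m); [apply: block_min_le; have [] := pblock_in (pi_part n) (f i)|exact: (ltn_ord i)].
have small B : B \in pi n -> block_min B < x -> res B != set0.
  move=> Bp Bx; have [j jB je] := block_min_in (partition_nonempty (pi_part n) Bp).
  have jm : j < m by rewrite -je (ltn_trans Bx).
  by apply/set0Pn; exists (Ordinal jm); rewrite inE (_ : f _ = j)//; exact: val_inj.
have -> : [set B in pi m | block_min B < x] = [set res B | B in [set B in pi n | block_min B < x]].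
  apply/setP => B'; rewrite inE -{1}(pi_restrict mn) !inE.
  apply/andP/imsetP => [[/andP[B'0 /imsetP[B Bp B'E]] B'x]|[B]].
    exists B => //; rewrite inE Bp /=; move: B'x; rewrite B'E block_min_restrict// -/(res B).
    by rewrite /res /f -B'E.
  rewrite inE => /andP[Bp Bx] ->; have rB := small B Bp Bx.
  by rewrite rB /= block_min_restrict// imset_f.
rewrite card_in_imset// => B B'; rewrite !inE => /andP[Bp Bx] /andP[B'p B'x] e.
have /set0Pn[j jB] := small B Bp Bx.
rewrite inE in jB; have jB' : f j \in B' by have : j \in res B' by [rewrite -e inE]; rewrite inE.
by rewrite -(partition_pblock (pi_part n) Bp jB) (partition_pblock (pi_part n) B'p jB').
Qed.
End Restriction.

Lemma arrival_labelE n (i : 'I_n) : arrival_label i = block_index (pi n) i.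
Proof.
rewrite /arrival_label -(block_index_restrict (ltn_ord i)); congr block_index.
exact: val_inj.
Qed.

Lemma consistent_induced n : pi n = induced_partition n arrival_label.
Proof.
rewrite /induced_partition -[LHS](preim_partition_pblock (pi_part n)).
rewrite /preim_partition; apply: eq_imset => i; apply/setP => j; rewrite !inE.
by rewrite !arrival_labelE block_index_eq.
Qed.

Lemma arrival_label_range n k :
  (k \in [seq arrival_label i | i <- iota 0 n]) = (k < #|pi n|).
Proof.
apply/mapP/idP => [[i]|kn].
  rewrite mem_iota add0n => /andP[_ ilt] ->.
  by rewrite (arrival_labelE (Ordinal ilt)) block_index_lt.
have [i ik] := block_index_onto (pi_part n) kn.
by exists (i : nat); rewrite ?mem_iota ?add0n ?ltn_ord// arrival_labelE.
Qed.

Lemma card_induced_undup (T : eqType) (x : nat -> T) n :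
  #|induced_partition n x| = size (undup [seq x i | i <- iota 0 n]).
Proof.
rewrite card_induced_partition; elim: n => [|n IH]; first by rewrite big_ord0.
rewrite -[n.+1 in RHS]addn1 iotaD map_cat add0n big_ord_recr IH /=.
rewrite [RHS](perm_size (perm_undup (_ : _ =i x n :: [seq x i | i <- iota 0 n]))).
  by rewrite /= /new_value; case: (x n \in _); rewrite /= ?addn0 ?addn1.
by move=> v; rewrite mem_cat !inE orbC.
Qed.

(** The labels of the first n elements are exactly 0, ..., #|pi n| - 1. *)
Lemma card_induced_relabel (T : eqType) (y : nat -> T) n :
  #|induced_partition n (fun i => y (arrival_label i))| = #|induced_partition #|pi n| y|.
Proof.
rewrite !card_induced_undup; apply: perm_size; apply: perm_undup => v.
apply/mapP/mapP => [[i ilt ->]|[k klt ->]].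
  exists (arrival_label i) => //; rewrite mem_iota add0n /= -arrival_label_range.
  exact: map_f.
move: klt; rewrite mem_iota add0n /= -arrival_label_range => /mapP[i ilt ->].
by exists i.
Qed.
End ConsistentPartitions.

(** The form of [induced_partition] for vectors, on which permutations of the
    indices act. *)
Definition kernel_partition (n : nat) (T : eqType) (z : 'I_n -> T) : {set {set 'I_n}} :=
  preim_partition z [set: 'I_n]%SET.

Lemma induced_kernel (n : nat) (T : eqType) (x : nat -> T) :
  induced_partition n x = kernel_partition (fun i : 'I_n => x i).
Proof. by []. Qed.

Lemma kernel_partition_is (n : nat) (T : eqType) (z : 'I_n -> T) :
  is_partition (kernel_partition z).
Proof. exact: preim_partitionP. Qed.

Lemma mem_pblock_kernel (n : nat) (T : eqType) (z : 'I_n -> T) i j :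
  (j \in finset.pblock (kernel_partition z) i) = (z i == z j).
Proof.
rewrite /kernel_partition /preim_partition pblock_equivalence_partition ?inE//.
by move=> a b c _ _ _ /=; split => // /eqP ->.
Qed.

Lemma kernel_partitionP (n : nat) (T : eqType) (z : 'I_n -> T) p : is_partition p ->
  kernel_partition z = p <-> forall i j, (z i == z j) = (j \in finset.pblock p i).
Proof.
move=> pp; split=> [<- i j|h]; first by rewrite mem_pblock_kernel.
rewrite -[RHS](preim_partition_pblock pp) /kernel_partition /preim_partition.
rewrite /equivalence_partition; apply: eq_imset => i; apply/setP => j; rewrite !inE h.
have [ip iB] := pblock_in pp i; have [jp jB] := pblock_in pp j.
apply/idP/eqP => [ji|->//].
by rewrite (partition_pblock pp ip ji).
Qed.

Lemma kernel_partition_eq (n : nat) (T T' : eqType) (z : 'I_n -> T) (z' : 'I_n -> T') :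
  (forall i j, (z i == z j) = (z' i == z' j)) -> kernel_partition z = kernel_partition z'.
Proof.
move=> zz'; apply/kernel_partitionP; first exact: kernel_partition_is.
by move=> i j; rewrite zz' mem_pblock_kernel.
Qed.

Lemma kernel_partition_perm (n : nat) (T : eqType) (z : 'I_n -> T) (s : {perm 'I_n}) :
  perm_partition s (kernel_partition (fun i => z (s i))) = kernel_partition z.
Proof.
apply/setP => B; apply/imsetP/imsetP => [[_ /imsetP[i _ ->] ->]|[i _ ->]].
  exists (s i) => //; apply/setP => j; rewrite !inE.
  rewrite -[j in LHS](permKV s) (mem_imset _ _ (@perm_inj _ s)) !inE.
  by rewrite permKV.
exists [set j in [set: 'I_n] | z (s ((s^-1)%g i)) == z (s j)]%SET.
  by apply/imsetP; exists ((s^-1)%g i).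
apply/setP => j; rewrite !inE.
rewrite -[j in RHS](permKV s) (mem_imset _ _ (@perm_inj _ s)) !inE.
by rewrite !permKV.
Qed.

Section BlockIndexKernel.
Variable n : nat.
Implicit Types (p : {set {set 'I_n}}) (s : {perm 'I_n}).

Lemma kernel_block_index p : is_partition p -> kernel_partition (block_index p) = p.
Proof.
move=> pp; apply/(kernel_partitionP _ pp) => i j; rewrite block_index_eq//.
have [ip iB] := pblock_in pp i; have [jp jB] := pblock_in pp j.
apply/eqP/idP => [->//|ji].
by rewrite (partition_pblock pp ip ji).
Qed.

Lemma perm_kernel_partition (T : eqType) s (z : 'I_n -> T) :
  perm_partition s (kernel_partition z) = kernel_partition (fun i => z ((s^-1)%g i)).
Proof.
rewrite -[RHS](kernel_partition_perm _ s); congr (perm_partition s _).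
by apply: kernel_partition_eq => i j; rewrite !permK.
Qed.

Lemma perm_partition_is s p : is_partition p -> is_partition (perm_partition s p).
Proof.
move=> pp; rewrite -(kernel_block_index pp) perm_kernel_partition.
exact: kernel_partition_is.
Qed.

Lemma block_index_perm s p i j : is_partition p ->
  (block_index (perm_partition s p) (s i) == block_index (perm_partition s p) (s j)) =
  (block_index p i == block_index p j).
Proof.
move=> pp; have spp := perm_partition_is s pp.
rewrite -(mem_pblock_kernel (block_index _)) kernel_block_index//.
by rewrite -{1}(kernel_block_index pp) perm_kernel_partition mem_pblock_kernel !permK.
Qed.
End BlockIndexKernel.

From mathcomp Require Import finmap all_classical all_reals all_analysis.
From mathcomp Require Import measurable_realfun.
Import numFieldTopology.Exports numFieldNormedType.Exports.

Local Open Scope classical_set_scope.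
Local Open Scope ring_scope.

(** * Convergence along sparse subsequences *)

Lemma invr_truncnS_le (R : archiRealFieldType) (e : R) : 0 < e ->
  (Num.truncn e^-1).+1%:R^-1 <= e.
Proof.
move=> e0; rewrite -[leRHS]invrK lef_pV2 ?posrE ?invr_gt0//.
have : 0 <= e^-1 by rewrite invr_ge0 ltW.
by move=> /truncn_itv /andP[_ /ltW].
Qed.

Lemma eq_near_cvg (R : realType) (u v : nat -> R) (l : R) :
  (\forall n \near \oo, u n = v n) -> u n @[n --> \oo] --> l -> v n @[n --> \oo] --> l.
Proof. by move=> uv; apply: cvg_trans; apply: near_eq_cvg; exact: filterS uv. Qed.

Lemma eq_near_cvgB (R : realType) (u v w : nat -> R) (l m : R) :
  u n @[n --> \oo] --> l -> v n @[n --> \oo] --> m ->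
  (\forall n \near \oo, u n - v n = w n) -> w n @[n --> \oo] --> l - m.
Proof. by move=> ul vm uvw; apply: eq_near_cvg uvw _; exact: cvgB. Qed.

Lemma cvg_power_ratio (R : realType) (b q : nat) : (0 < b)%N ->
  (b * j.+2 ^ q)%N%:R / (b * j.+1 ^ q)%N%:R @[j --> \oo] --> (1 : R).
Proof.
move=> b0.
have h : 1 + (j.+1%:R : R)^-1 @[j --> \oo] --> (1 + 0 : R).
  by apply: cvgD; [exact: cvg_cst|exact: cvg_harmonic].
have h2 : (1 + (j.+1%:R : R)^-1) ^+ q @[j --> \oo] --> (1 + 0 : R) ^+ q.
  exact: (cvg_comp _ _ h (@exprn_continuous _ q _)).
rewrite addr0 expr1n in h2; apply: (eq_near_cvg _ h2); apply: nearW => j /=.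
rewrite !natrM !natrX -mulf_div divff ?pnatr_eq0 -?lt0n// mul1r -expr_div_n -[j.+2%:R]natr1.
by rewrite mulrDl divff// mul1r.
Qed.

(** For N j <= n < N (j + 1), monotonicity puts u n / v n between
    u (N j) / v (N (j + 1)) and u (N (j + 1)) / v (N j). *)
Lemma squeeze_subsequence (R : realType) (u v : nat -> R) (N : nat -> nat) (L : R) :
  (forall n, 0 <= u n) -> {homo u : m n / (m <= n)%N >-> m <= n} ->
  {homo v : m n / (m <= n)%N >-> m <= n} -> (forall j, 0 < v (N j)) ->
  {homo N : i j / (i < j)%N} ->
  u (N j) / v (N j) @[j --> \oo] --> L -> v (N j.+1) / v (N j) @[j --> \oo] --> (1 : R) ->
  u n / v n @[n --> \oo] --> L.
Proof.
move=> u0 uh vh v0 Nh uL v1.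
have Nge j : (j <= N j)%N by elim: j => // j IH; apply: leq_ltn_trans IH _; exact: Nh.
pose J n := (\max_(j < n.+1 | (N j <= n)%N) j)%N.
have JN n : (N 0%N <= n)%N -> (N (J n) <= n)%N /\ (n < N (J n).+1)%N.
  move=> Nn; split.
    rewrite /J; apply: (big_ind (fun j => (N j <= n)%N)) => //.
    by move=> i j; rewrite /maxn; case: ifP.
  rewrite ltnNge; apply/negP => h.
  have Jn : ((J n).+1 < n.+1)%N by rewrite ltnS; apply: leq_trans (Nge _) h.
  by have := @leq_bigmax_cond _ (fun j : 'I_n.+1 => (N j <= n)%N) (fun j => j) (Ordinal Jn) h; rewrite /= ltnn.
have Joo : J n @[n --> \oo] --> \oo.
  move=> A [k _ kA]; exists (N k) => // n /= Nn; apply: kA => /=.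
  have kn : (k < n.+1)%N by rewrite ltnS; apply: leq_trans (Nge _) Nn.
  exact: (@leq_bigmax_cond _ (fun j : 'I_n.+1 => (N j <= n)%N) (fun j => j) (Ordinal kn)).
have vV : v (N j) / v (N j.+1) @[j --> \oo] --> (1 : R).
  rewrite (_ : (fun j => _) = (fun j => (v (N j.+1) / v (N j))^-1)).
    by rewrite -[X in _ --> X]invr1; apply: cvgV => //; rewrite oner_eq0.
  by apply/funext => j; rewrite invf_div.
have lo : u (N j) / v (N j) * (v (N j) / v (N j.+1)) @[j --> \oo] --> L.
  by rewrite -[L]mulr1; exact: cvgM.
have hi : u (N j.+1) / v (N j.+1) * (v (N j.+1) / v (N j)) @[j --> \oo] --> L.
  rewrite -[L]mulr1; apply: cvgM => //.
  by move: uL; rewrite -cvg_shiftS.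
apply: (squeeze_cvgr _ (cvg_comp _ _ Joo lo) (cvg_comp _ _ Joo hi)).
near=> n.
have [NJ1 NJ2] : (N (J n) <= n)%N /\ (n < N (J n).+1)%N.
  by apply: JN; near: n; exact: nbhs_infty_ge.
have vn0 : 0 < v n by apply: lt_le_trans (v0 _) (vh _ _ NJ1).
have e1 : u (N (J n)) / v (N (J n)) * (v (N (J n)) / v (N (J n).+1)) = u (N (J n)) / v (N (J n).+1).
  by rewrite mulrA divfK// gt_eqF.
have e2 : u (N (J n).+1) / v (N (J n).+1) * (v (N (J n).+1) / v (N (J n))) = u (N (J n).+1) / v (N (J n)).
  by rewrite mulrA divfK// gt_eqF.
rewrite /= e1 e2; apply/andP; split.
  apply: ler_pM => //; [by rewrite invr_ge0 ltW|exact: uh|].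
  by rewrite lef_pV2 ?posrE// vh// ltnW.
apply: ler_pM => //; [by rewrite invr_ge0 ltW|exact/uh/ltnW|].
by rewrite lef_pV2 ?posrE// vh.
Unshelve. all: by end_near. Qed.

(** Strong induction by halving: from j to its half, (j + 1)^2 is divided by at
    most 4 and f by at least 4.  The shift from j to j + 1 absorbs the rounding
    for odd j. *)
Lemma quadratic_growth (R : realFieldType) (f : nat -> R) (j0 : nat) :
  {homo f : i j / (i <= j)%N >-> i <= j} -> (forall j, (0 < j)%N -> 1 <= f j) ->
  (forall j, (j0 <= j)%N -> 4 * f j <= f j.*2) ->
  exists2 M : nat, (0 < M)%N & forall j, (0 < j)%N -> (j.+1 ^ 2)%N%:R <= M%:R * f j.
Proof.
move=> fh f1 f4; exists ((j0.+1.*2.+1) ^ 2)%N => // j.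
have [k] := ubnP j; elim: k j => // k IH j jk j0'.
have [jj|jj] := ltnP j j0.+1.*2.
  apply: (@le_trans _ _ ((j0.+1.*2.+1 ^ 2)%N%:R * 1)); last by rewrite ler_wpM2l ?f1.
  by rewrite mulr1 ler_nat leq_exp2r// ltnW.
have h2 : (j./2.*2 <= j)%N by have := odd_double_half j; lia.
have h3 : (j.+1 <= j./2.+1.*2)%N by have := odd_double_half j; lia.
have IHj := IH j./2 ltac:(lia) ltac:(lia).
apply: (@le_trans _ _ (4 * (j./2.+1 ^ 2)%N%:R)).
  by rewrite -natrM ler_nat (_ : 4 = 2 ^ 2)%N// -expnMn leq_exp2r// mul2n.
apply: (@le_trans _ _ (4 * ((j0.+1.*2.+1 ^ 2)%N%:R * f j./2))).
  by rewrite ler_wpM2l.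
rewrite mulrCA ler_wpM2l//; apply: le_trans (f4 _ _) (fh _ _ h2).
lia.
Qed.

(** * Generating functions and the binomial series *)

(** Once the coefficients below r are known, those above r contribute at most
    s^(r+1) because the total mass is at most 1; after division by s^r a small s
    determines the limit of the r-th coefficient.  The points s = 1/b suffice
    since they accumulate at 0. *)
Lemma pgf_inversion (R : realType) (u : nat -> nat -> R) (p : nat -> R) (g : R -> R) :
  (forall N r, 0 <= u N r) ->
  (forall N, \sum_(r < N.+1) u N r <= 1) ->
  (forall b, (1 < b)%N ->
     \sum_(r < N.+1) u N r * b%:R^-1 ^+ r @[N --> \oo] --> g b%:R^-1) ->
  (forall r, exists C : R, forall s : R, 0 <= s <= 1 / 2 ->
     `|g s - \sum_(j < r) p j * s ^+ j| <= C * s ^+ r) ->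
  forall r, u N r @[N --> \oo] --> p r.
Proof.
move=> u0 u1 ug gp; elim/ltn_ind => r IH.
have [C0 HC0] := gp r.+1; pose C := `|C0|.
have HC (s : R) : 0 <= s <= 1 / 2 -> `|g s - \sum_(j < r.+1) p j * s ^+ j| <= C * s ^+ r.+1.
  move=> s01; apply: le_trans (HC0 s s01) _.
  by rewrite ler_wpM2r ?exprn_ge0 ?ler_norm//; case/andP: s01.
apply/cvgrPdist_le => e e0.
(* the error made by stopping at s = 1 / b is at most (C + 2) s *)
pose b := (Num.truncn ((C + 2) / e)).+2.
have b1 : (1 < b)%N by [].
pose s : R := b%:R^-1.
have s0 : 0 < s by rewrite invr_gt0 ltr0n.
have s12 : s <= 1 / 2 by rewrite mul1r lef_pV2 ?posrE ?ltr0n// ler_nat.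
have Cs : (C + 2) * s <= e.
  rewrite ler_pdivrMr ?ltr0n// mulrC -ler_pdivrMr//.
  have : 0 <= (C + 2) / e by rewrite divr_ge0 ?(ltW e0)// addr_ge0// normr_ge0.
  move=> /truncn_itv /andP[_ /ltW h]; apply: le_trans h _.
  by rewrite ler_nat.
have A0 : `|\sum_(r < N.+1) u N r * s ^+ r - g s| + \sum_(j < r) `|u N j - p j| @[N --> \oo] --> 0 + \sum_(j < r) (0 : R).
  apply: cvgD.
    apply/cvgr0Pnorm_le => d d0; near=> N; rewrite normr_id distrC; near: N.
    by move/cvgrPdist_le : (ug b b1) => /(_ d d0).
  apply: cvg_big => [|j _]; first exact: add_continuous.
  apply/cvgr0Pnorm_le => d d0; near=> N; rewrite normr_id distrC; near: N.
  by have /cvgrPdist_le /(_ d d0) := IH j (ltn_ord j).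
move: A0; rewrite big1 ?addr0// => /cvgrPdist_le /(_ (s ^+ r.+1)) A0.
have sr0 : 0 < s ^+ r.+1 by rewrite exprn_gt0.
near=> N.
have rN : (r < N.+1)%N by near: N; apply: nbhs_infty_ge.
have : `|0 - (`|\sum_(r < N.+1) u N r * s ^+ r - g s| + \sum_(j < r) `|u N j - p j|)| <= s ^+ r.+1.
  by near: N; exact: A0.
rewrite sub0r normrN ger0_norm; last by rewrite addr_ge0// sumr_ge0.
set D := (X in `|X| + _); set E := \sum_(j < r) _ => DE.
pose Hd : R := \sum_(j < r) u N j * s ^+ j.
pose Hp : R := \sum_(j < r) p j * s ^+ j.
pose Tl : R := \sum_(r.+1 <= k < N.+1) u N k * s ^+ k.
have split_sum : \sum_(k < N.+1) u N k * s ^+ k = Hd + u N r * s ^+ r + Tl.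
  rewrite -(big_mkord xpredT (fun k => u N k * s ^+ k)) (@big_cat_nat _ _ _ r)//=; last exact: ltnW.
  by rewrite big_mkord -addrA; congr (_ + _); rewrite big_ltn.
have s1 : s <= 1 by lra.
have Tl0 : 0 <= Tl by apply: sumr_ge0 => k _; rewrite mulr_ge0// exprn_ge0// ltW.
have Tl1 : Tl <= s ^+ r.+1.
  apply: (@le_trans _ _ (\sum_(r.+1 <= k < N.+1) u N k * s ^+ r.+1)).
    rewrite [leLHS]big_nat [leRHS]big_nat; apply: ler_sum => k /andP[rk _].
    by rewrite ler_wpM2l// ler_wiXn2l// ltW.
  rewrite -mulr_suml -[leRHS]mul1r ler_wpM2r ?(ltW sr0)//; apply: le_trans (u1 N).
  rewrite -(big_mkord xpredT (u N)) [leRHS](@big_cat_nat _ _ _ r.+1)//=.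
  by rewrite lerDr sumr_ge0.
have HdE : `|Hd - Hp| <= E.
  rewrite /Hd /Hp -sumrB; apply: le_trans (ler_norm_sum _ _ _) _; apply: ler_sum => j _.
  rewrite -mulrBl normrM -[leRHS]mulr1 ler_wpM2l// ger0_norm ?exprn_ge0 ?(ltW s0)//.
  by rewrite exprn_ile1// ltW.
have gs := HC s ltac:(by rewrite (ltW s0)).
have key : (p r - u N r) * s ^+ r = (Hd - Hp) - D + Tl - (g s - \sum_(j < r.+1) p j * s ^+ j).
  by rewrite big_ord_recr /= -/Hp /D split_sum; ring.
have : `|(p r - u N r) * s ^+ r| <= (C + 2) * s * s ^+ r.
  rewrite key; apply: le_trans (ler_normB _ _) _.
  have h1 := ler_normD (Hd - Hp - D) Tl; have h2 := ler_normB (Hd - Hp) D.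
  rewrite (ger0_norm Tl0) in h1.
  have -> : (C + 2) * s * s ^+ r = C * s ^+ r.+1 + 2 * s ^+ r.+1 by rewrite exprS; ring.
  lra.
rewrite normrM [X in _ * X]ger0_norm ?exprn_ge0 ?(ltW s0)// ler_pM2r ?exprn_gt0// => h.
exact: le_trans h Cs.
Unshelve. all: by end_near. Qed.

(** The coefficient of s^j in (1 - s)^a. *)
Definition binom_coef (R : realType) (a : R) (j : nat) : R :=
  \prod_(i < j) ((i%:R - a) / i.+1%:R).

Lemma binom_coefS (R : realType) (a : R) (j : nat) :
  j.+1%:R * binom_coef a j.+1 = - a * binom_coef (a - 1) j.
Proof.
rewrite /binom_coef big_ord_recl /= sub0r.
elim: j => [|j IH]; first by rewrite !big_ord0; field.
rewrite [in LHS]big_ord_recr [in RHS]big_ord_recr /=.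
transitivity ((j.+1%:R * (- a / 1 * \prod_(i < j) (((lift ord0 i)%:R - a) / (lift ord0 i).+1%:R)))
   * ((j.+1%:R - a) / j.+1%:R)).
  rewrite /bump /= add1n; field; have j0 := ler0n R j.
  by apply/andP; split; apply: lt0r_neq0; lra.
rewrite [X in X * _](_ : _ = - a * \prod_(i < j) ((i%:R - (a - 1)) / i.+1%:R)).
  by rewrite -natr1; ring.
exact: IH.
Qed.

(** Induction on r for all exponents at once: by [binom_coefS] the derivative of
    the remainder for the exponent a is - a times the remainder for a - 1, and
    the mean value theorem carries the bound over. *)
Lemma binom_expansion (R : realType) (r : nat) (a : R) : exists C : R,
  forall s : R, 0 <= s <= 1 / 2 ->
  `|(1 - s) `^ a - \sum_(j < r) binom_coef a j * s ^+ j| <= C * s ^+ r.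
Proof.
elim: r a => [|r IH] a.
  exists (1 + (1 / 2) `^ a) => s /andP[s0 s1].
  rewrite big_ord0 subr0 mulr1 ger0_norm ?powR_ge0//.
  have [a0|a0] := leP 0 a.
    rewrite (@le_trans _ _ 1) ?lerDl ?powR_ge0//.
    by have := @ge0_ler_powR R a a0 (1 - s) 1; rewrite powR1 !nnegrE => -> //; lra.
  rewrite (@le_trans _ _ ((1 / 2) `^ a)) ?lerDr//.
  rewrite -[a]opprK !(powRN _ (- a)) lef_pV2 ?posrE ?powR_gt0//; try lra.
  by rewrite ge0_ler_powR// ?nnegrE; lra.
have [C HC] := IH (a - 1); exists (`|a| * C) => s /andP[s0 s1].
pose f s : R := (1 - s) `^ a - \sum_(j < r.+1) binom_coef a j * s ^+ j.
pose df s : R := - a * ((1 - s) `^ (a - 1) - \sum_(j < r) binom_coef (a - 1) j * s ^+ j).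
have dfP (x : R) : x < 1 -> is_derive x 1 f (df x).
  move=> x1.
  pose p := \poly_(j < r.+1) binom_coef a j.
  have pd : p^`() = - a *: \poly_(j < r) binom_coef (a - 1) j.
    apply/polyP => j; rewrite coef_deriv coefZ !coef_poly ltnS.
    by case: ifP => _; rewrite ?mul0rn ?mulr0// -binom_coefS mulr_natl.
  have fE : f = (fun t : R => (1 - t) `^ a) - (fun t : R => p.[t]).
    by apply/funext => t; rewrite -[RHS]/((1 - t) `^ a - p.[t]) /p horner_poly.
  have d1 : is_derive x 1 (fun t : R => (1 - t) `^ a) (- (a * (1 - x) `^ (a - 1))).
    have x10 : 0 < 1 - x by lra.
    have d0 : is_derive x 1 (fun t : R => 1 - t) (-1).
      by have := is_deriveB (is_derive_cst (1 : R) x 1) (is_derive_id x 1); rewrite sub0r.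
    have := @is_derive1_comp R (fun y : R => y `^ a) (fun t : R => 1 - t) x _ _ (is_derive1_powR a x10) d0.
    by rewrite mulrN1.
  rewrite fE /df; apply: is_derive_eq.
  by rewrite pd hornerZ horner_poly; ring.
have cf : {within `[0, s], continuous f}.
  apply: derivable_within_continuous => y; rewrite in_itv/= => /andP[_ ys].
  by have [] := dfP y ltac:(lra).
have f0 : f 0 = 0.
  rewrite /f subr0 powR1 big_ord_recl /= big1 => [|i _]; last by rewrite /bump/= expr0n mulr0.
  by rewrite /binom_coef big_ord0 expr0 mulr1 addr0 subrr.
have [y|c] := MVT_segment s0 _ cf (df := df).
  by rewrite in_itv/= => /andP[_ ys]; apply: dfP; lra.
rewrite in_itv /= f0 !subr0 => /andP[c0 cs] fs; rewrite -/(f s) fs.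
rewrite exprSr mulrA normrM (ger0_norm s0) ler_wpM2r// /df normrM normrN -mulrA ler_wpM2l//.
apply: le_trans (HC c _) _; first by rewrite c0 (le_trans cs).
have C0 : 0 <= C.
  have := HC (1 / 2) ltac:(by rewrite lexx andbT).
  move=> /(le_trans (normr_ge0 _)); by rewrite pmulr_lge0.
by rewrite ler_wpM2l// lerXn2r.
Qed.

(** * Regular variation along the integers *)

(** Regular variation at rational ratios, along multiples, so that no rounding
    occurs. *)
Definition regular_at (R : realType) (K : nat -> R) (sigma : R) : Prop :=
  forall a b, (0 < a)%N -> (0 < b)%N ->
    K (a * m)%N / K (b * m)%N @[m --> \oo] --> (a%:R / b%:R) `^ sigma.

(** For every positive integer a, the integer N (j + 1) is eventually at most
    (a + 1) floor (N j / a), where K exceeds K (N j) by a factor close to at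
    most ((a + 1) / a)^sigma <= 1 + 1 / a. *)
Lemma regular_ratio (R : realType) (K : nat -> R) (sigma : R) (N : nat -> nat) :
  0 < sigma <= 1 -> regular_at K sigma ->
  {homo K : m n / (m <= n)%N >-> m <= n} -> (forall n, (0 < n)%N -> 0 < K n) ->
  (forall j, 0 < N j)%N -> {homo N : i j / (i < j)%N} ->
  (N j.+1)%:R / (N j)%:R @[j --> \oo] --> (1 : R) ->
  K (N j.+1) / K (N j) @[j --> \oo] --> (1 : R).
Proof.
move=> /andP[sg0 sg1] Kreg Kh K0 N0 Nh N1.
have Nge j : (j <= N j)%N by elim: j => // j IH; apply: leq_ltn_trans IH _; exact: Nh.
apply/cvgrPdist_le => e e0.
pose a := (Num.truncn (2 / e)).+1.
have a0 : (0 < a)%N by [].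
have a0R : 0 < a%:R :> R by rewrite ltr0n.
have ae : a.+1%:R / a%:R <= 1 + e / 2.
  rewrite -natr1 mulrDl divff ?gt_eqF// lerD2l mul1r -(invrK (e / 2)) invf_div.
  rewrite lef_pV2 ?posrE ?divr_gt0//.
  have : 0 <= 2 / e by rewrite divr_ge0 // ltW.
  by move=> /truncn_itv /andP[_ /ltW].
have ra : (a.+1%:R / a%:R) `^ sigma <= 1 + e / 2.
  apply: le_trans ae; rewrite -[leRHS]powRr1 ?divr_ge0//.
  by apply: ler_powR => //; rewrite ler_pdivlMr// mul1r ler_nat.
pose m j := (N j %/ a)%N.
have moo : m j @[j --> \oo] --> \oo.
  move=> A [k _ kA]; exists (k * a)%N => // j /= kj; apply: kA => /=.
  by rewrite /m leq_divRL//; apply: leq_trans kj (Nge j).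
have ev1 := cvg_comp _ _ moo (Kreg a.+1 a (ltn0Sn _) a0).
have {}ev1 : \forall j \near \oo, K (a.+1 * m j)%N / K (a * m j)%N <= 1 + e.
  have /cvgrPdist_le /(_ (e / 2)) := ev1; rewrite divr_gt0// => /(_ isT) h.
  near=> j; have : `|(a.+1%:R / a%:R) `^ sigma - K (a.+1 * m j)%N / K (a * m j)%N| <= e / 2.
    by near: j; exact: h.
  by move=> /ler_normlP []; lra.
(* eventually N (j + 1) <= (1 + 1 / (2 a)) N j, which leaves room for the
   remainder of N j modulo a *)
have ev2 : \forall j \near \oo, (N j.+1 <= a.+1 * m j)%N.
  have d0 : 0 < (2 * a%:R)^-1 :> R by rewrite invr_gt0 mulr_gt0.
  have /cvgrPdist_le /(_ _ d0) h := N1.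
  near=> j.
  have hj : `|1 - (N j.+1)%:R / (N j)%:R| <= (2 * a%:R)^-1 :> R by near: j; exact: h.
  have jbig : (2 * a * a.+1 <= N j)%N.
    by apply: leq_trans (Nge j); near: j; exact: nbhs_infty_ge.
  have Nj0 : 0 < (N j)%:R :> R by rewrite ltr0n.
  have {}hj : (2 * a * N j.+1 <= (2 * a).+1 * N j)%N.
    have : (N j.+1)%:R / (N j)%:R <= 1 + (2 * a%:R)^-1 :> R.
      by move: hj => /ler_normlP []; lra.
    rewrite ler_pdivrMr// => h2.
    rewrite -(ler_nat R) !natrM -[(2 * a).+1%:R]natr1 natrM.
    apply: le_trans (ler_wpM2l _ h2) _; first by rewrite mulr_ge0.
    by rewrite mulrA mulrDr mulr1 mulfV// mulf_neq0// gt_eqF.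
  have := divn_eq (N j) a; have := ltn_pmod (N j) a0; rewrite -/(m j) => h3 h4.
  have h5 : (2 * a * (a.+1 * m j) + 2 * a.+1 * a >= 2 * a.+1 * N j)%N.
    have : (N j <= m j * a + a)%N by lia.
    by nia.
  have : (2 * a * N j.+1 <= 2 * a * (a.+1 * m j))%N by nia.
  by rewrite leq_pmul2l// muln_gt0.
near=> j.
have KN0 : 0 < K (N j) by exact: K0.
have h1 : 1 <= K (N j.+1) / K (N j) by rewrite ler_pdivlMr// mul1r Kh// ltnW// Nh.
have am0 : (0 < a * m j)%N.
  rewrite muln_gt0 a0 /m divn_gt0//; apply: leq_trans (Nge j).
  by near: j; exact: nbhs_infty_ge.
have h2 : K (N j.+1) / K (N j) <= 1 + e.
  apply: (@le_trans _ _ (K (a.+1 * m j)%N / K (a * m j)%N)); last by near: j; exact: ev1.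
  apply: ler_pM; rewrite ?invr_ge0 ?(ltW (K0 _ _))//.
    by apply: Kh; near: j; exact: ev2.
  by rewrite lef_pV2 ?posrE ?K0// Kh// mulnC leq_trunc_div.
by rewrite ler0_norm; lra.
Unshelve. all: by end_near. Qed.

(** By the condition on q, doubling a large j multiplies K (j^q) by at least 4. *)
Lemma regular_growth (R : realType) (K : nat -> R) (sigma : R) (q b : nat) :
  regular_at K sigma ->
  {homo K : m n / (m <= n)%N >-> m <= n} -> (forall n, (0 < n)%N -> 1 <= K n) ->
  (0 < q)%N -> (0 < b)%N -> 4 < (2 ^ q)%N%:R `^ sigma :> R ->
  exists2 M : nat, (0 < M)%N & forall j, (0 < j)%N -> (j.+1 ^ 2)%N%:R <= M%:R * K (b * j ^ q)%N.
Proof.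
move=> Kreg Kh K1 q0 b0 q4.
have h := Kreg _ _ (_ : 0 < 2 ^ q)%N (ltn0Sn 0).
have /cvgrPdist_lt /(_ ((2 ^ q)%N%:R `^ sigma - 4)) := h (expn_gt0 _ _).
rewrite subr_gt0 => /(_ q4) [n0 _ hn0].
have [||j jn0|M M0 HM] := @quadratic_growth R (fun j => K (j ^ q)%N) n0.+1.
- by move=> i j ij; apply: Kh; rewrite leq_exp2r.
- by move=> j j0; apply: K1; rewrite expn_gt0 j0.
- have j0 : (0 < j)%N by apply: leq_trans jn0.
  have jq : (0 < j ^ q)%N by rewrite expn_gt0 j0.
  have /= := hn0 (j ^ q)%N; rewrite mul1n divr1.
  have -> : (n0 <= j ^ q)%N.
    by apply: leq_trans (ltnW jn0) _; rewrite -{1}[j]expn1 leq_pexp2l.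
  move=> /(_ isT) /ltr_normlP[_ h3].
  have : 4 < K (2 ^ q * j ^ q)%N / K (j ^ q)%N by lra.
  rewrite ltr_pdivlMr ?(lt_le_trans ltr01 (K1 _ jq))// -expnMn mul2n.
  exact: ltW.
exists M => // j j0; apply: le_trans (HM _ j0) _.
by rewrite ler_wpM2l// Kh// leq_pmull.
Qed.

(** Between the points a m and b m the argument of l changes by the fixed ratio
    a / b, so that pointwise slow variation is enough. *)
Lemma regular_of_slowly_varying (R : realType) (u : nat -> R) (S sigma : R) (l : R -> R) :
  slowly_varying l -> 0 < S ->
  u n / (n%:R `^ sigma * l n%:R) @[n --> \oo] --> S -> regular_at u sigma.
Proof.
move=> [[A _ lpos] lsv] S0 uS a b a0 b0.
pose c n : R := n%:R `^ sigma * l n%:R.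
have mul_oo k : (0 < k)%N -> (k * m)%N @[m --> \oo] --> \oo.
  move=> k0 B [N _ NB]; exists N => // m /= Nm; apply: NB => /=.
  by apply: leq_trans Nm _; rewrite leq_pmull.
have c_gt0 : \forall n \near \oo, 0 < c n.
  near=> n; rewrite mulr_gt0//.
    by rewrite powR_gt0// ltr0n; near: n; exact: nbhs_infty_gt.
  by apply: lpos; near: n; exact: nbhs_infty_ger.
have aR0 : 0 < a%:R :> R by rewrite ltr0n.
have bR0 : 0 < b%:R :> R by rewrite ltr0n.
have bm_oo : ((b * m)%N%:R : R) @[m --> \oo] --> +oo.
  exact: (cvg_comp _ _ (mul_oo b b0) cvgr_idn).
have ab0 : 0 < a%:R / b%:R :> R by rewrite divr_gt0.
have cc : c (a * m)%N / c (b * m)%N @[m --> \oo] --> (a%:R / b%:R) `^ sigma.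
  have h := cvg_comp _ _ bm_oo (lsv _ ab0).
  rewrite -[X in _ --> X]mulr1.
  apply: (eq_near_cvg _ (cvgM (cvg_cst ((a%:R / b%:R) `^ sigma)) h)).
  near=> m; rewrite /c /=.
  have m0 : 0 < m%:R :> R by rewrite ltr0n; near: m; exact: nbhs_infty_gt.
  have bm0 : 0 < (b * m)%N%:R :> R by rewrite natrM mulr_gt0.
  have am : a%:R / b%:R * (b * m)%N%:R = (a * m)%N%:R :> R.
    by rewrite !natrM; field; rewrite gt_eqF.
  rewrite am -mulf_div; congr (_ * _).
  rewrite -am [in RHS]powRM ?(ltW ab0) ?(ltW bm0)// mulfK//.
  by rewrite gt_eqF// powR_gt0.
have ua := cvg_comp _ _ (mul_oo a a0) uS.
have ub := cvg_comp _ _ (mul_oo b b0) uS.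
have h : (u (a * m)%N / c (a * m)%N) * (c (a * m)%N / c (b * m)%N) / (u (b * m)%N / c (b * m)%N)
   @[m --> \oo] --> S * (a%:R / b%:R) `^ sigma / S.
  apply: cvgM; first exact: cvgM.
  by apply: cvgV => //; rewrite gt_eqF.
rewrite mulrAC divff ?gt_eqF// mul1r in h.
apply: (eq_near_cvg _ h); near=> m.
have ca : c (a * m)%N != 0 by rewrite gt_eqF//; near: m; exact: mul_oo c_gt0.
have cb : c (b * m)%N != 0 by rewrite gt_eqF//; near: m; exact: mul_oo c_gt0.
by rewrite invf_div mulrA divfK// mulrA divfK.
Unshelve. all: by end_near. Qed.

Lemma large_dyadic_power (R : realType) (sigma : R) : 0 < sigma ->
  exists2 q, (0 < q)%N & 4 < (2 ^ q)%N%:R `^ sigma :> R.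
Proof.
move=> s0; pose q := (Num.truncn (2 / sigma)).+1; exists q => //.
have qs : 2 < q%:R * sigma.
  rewrite -ltr_pdivrMr//.
  have : 0 <= 2 / sigma by rewrite divr_ge0// ltW.
  by move=> /truncn_itv /andP[].
rewrite natrX -powR_mulrn// -powRrM (_ : 4 = 2 `^ 2).
  by rewrite /powR pnatr_eq0/= ltr_expR ltr_pM2r// ln_gt0// ltr1n.
by rewrite powR_mulrn// -natrX.
Qed.

Lemma regular_infty (R : realType) (T : eqType) (x : nat -> T) (sigma : R) : 0 < sigma ->
  regular_at (fun n => #|induced_partition n x|%:R) sigma ->
  #|induced_partition n x| @[n --> \oo] --> \oo.
Proof.
move=> s0 reg; have [q q0 q4] := large_dyadic_power s0.
have [M M0 HM] := regular_growth reg (card_induced_partition_natr_homo _ _)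
  (card_induced_partition_natr_ge1 _ _) q0 (ltn0Sn 0) q4.
move=> B [N _ NB]; pose j := (M * N).+1; exists (1 * j ^ q)%N => // n /= jn; apply: NB => /=.
apply: leq_trans (card_induced_partition_homo x jn).
have := HM j (ltn0Sn _); rewrite -natrM ler_nat => h.
rewrite -(leq_pmul2l M0); apply: leq_trans h.
by rewrite /j; nia.
Qed.

(** * Averaging over permutations, and a Borel-Cantelli argument *)

Section AlmostSure.
Context {d : measure_display} {Omega : measurableType d} {R : realType}.
Variable P : probability Omega R.

Lemma measure_big_disjoint (I : choiceType) (r : seq I) (f : pred I) (F : I -> set Omega) :
  uniq r -> (forall i, measurable (F i)) -> (forall i j, i != j -> F i `&` F j = set0) ->
  P (\big[setU/set0]_(i <- r | f i) F i) = (\sum_(i <- r | f i) P (F i))%E.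
Proof.
move=> + mF dF; elim: r => [_|i r IH /= /andP[ir ur]]; first by rewrite !big_nil measure0.
rewrite !big_cons; case: ifP => _; last exact: IH.
rewrite measureU; [by congr (_ + _)%E; exact: IH|exact: mF|by apply: bigsetU_measurable => ? _|].
apply/seteqP; split => // w [Fi]; rewrite -bigcup_seq_cond/= => -[k /= /andP[kr _]] Fk.
have ik : i != k by apply: contraNneq ir => ->.
by have : (F i `&` F k) w by []; rewrite dF.
Qed.

(** The probabilities are summable by telescoping, since
    1 / t^2 <= 2 (1 / t - 1 / (t + 1)) for t >= 1. *)
Lemma borel_cantelli_quadratic (F : nat -> set Omega) (c : R) : 0 <= c ->
  (forall j, measurable (F j)) ->
  (forall j, (P (F j) <= (c / (j.+1 ^ 2)%:R)%:E)%E) ->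
  {ae P, forall w, exists j0, forall j, (j0 <= j)%N -> ~ F j w}.
Proof.
move=> c0 mF PF.
have tele j : c / (j.+1 ^ 2)%:R <= 2 * c * (j.+1%:R^-1 - j.+2%:R^-1).
  have j1 : 1 <= j.+1%:R :> R by rewrite ler1n.
  rewrite natrX -[j.+2%:R]natr1; move: j.+1%:R j1 => t t1.
  have -> : 2 * c * (t^-1 - (t + 1)^-1) = c * (2 / (t * (t + 1))).
    by field; apply/andP; split; apply: lt0r_neq0; lra.
  rewrite ler_wpM2l// -[leLHS]mul1r ler_pdivrMr; last by nra.
  by rewrite mulrAC ler_pdivlMr ?mul1r; nra.
have part n : (\sum_(0 <= j < n) P (F j) <= (2 * c)%:E)%E.
  apply: (@le_trans _ _ (2 * c * (1 - n.+1%:R^-1))%:E); last first.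
    by rewrite lee_fin -[leRHS]mulr1 ler_wpM2l ?mulr_ge0// gerBl invr_ge0.
  elim: n => [|n IH]; first by rewrite big_geq// lee_fin invr1 subrr mulr0.
  rewrite big_nat_recr//=; apply: le_trans (leeD IH (PF n)) _.
  rewrite -EFinD lee_fin; apply: le_trans (lerD (lexx _) (tele n)) _.
  by rewrite -mulrDr (_ : _ - _ + _ = 1 - n.+2%:R^-1)//; ring.
have sumF : (\sum_(j <oo) P (F j) < +oo)%E.
  apply: (@le_lt_trans _ _ (2 * c)%:E); last exact: ltry.
  apply: lime_le; first exact: is_cvg_nneseries.
  exact: nearW.
exists (lim_sup_set F); split.
- by apply: bigcap_measurable => // n _; apply: bigcup_measurable.
- exact: lim_sup_set_cvg0.
move=> w /= nw n _; apply: contrapT => h; apply: nw; exists n => j nj Fj.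
by apply: h; exists j.
Qed.

Section FiniteValued.
Variables (I : finType) (rho : Omega -> I).
Hypothesis rho_meas : forall p, measurable [set w | rho w = p].

Lemma finite_event_is (f : pred I) :
  [set w | f (rho w)] = \big[setU/set0]_(p | f p) [set w | rho w = p].
Proof.
apply/seteqP; split => w /=.
  by move=> frho; rewrite (bigD1 (rho w)) //=; left.
rewrite -bigcup_seq_cond/= => -[p /= /andP[_ fp]] rp; by rewrite rp.
Qed.

Lemma finite_event_measurable (f : pred I) :
  measurable [set w | f (rho w)].
Proof. by rewrite finite_event_is; apply: bigsetU_measurable => p _. Qed.

Lemma finite_event_prob (f : pred I) :
  P [set w | f (rho w)] = (\sum_(p | f p) P [set w | rho w = p])%E.
Proof.
rewrite finite_event_is measure_big_disjoint//.
- exact: index_enum_uniq.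
- move=> p p' /eqP pp'; apply/seteqP; split => // w [/= rp rp'].
  by apply: pp'; rewrite -rp.
Qed.

Definition finite_law (i : I) : R := fine (P [set w | rho w = i]).

Lemma finite_law_ge0 i : 0 <= finite_law i.
Proof. exact: fine_ge0. Qed.

Lemma finite_event_law (f : pred I) :
  P [set w | f (rho w)] = (\sum_(i | f i) finite_law i)%:E.
Proof.
rewrite finite_event_prob -sumEFin; apply: eq_bigr => i _.
by rewrite fineK// fin_num_measure.
Qed.

Lemma finite_law_total : \sum_i finite_law i = 1.
Proof.
have := finite_event_law predT; rewrite (_ : [set _ | _] = setT) ?probability_setT.
  by move=> [] ->.
by apply/seteqP; split.
Qed.
End FiniteValued.

Section Averaging.
Variables (N : nat) (rho : Omega -> {set {set 'I_N}}).
Hypothesis rho_part : forall w, is_partition (rho w).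
Hypothesis rho_meas : forall p, measurable [set w | rho w = p].
Hypothesis rho_exch : forall (s : {perm 'I_N}) p,
  P [set w | rho w = perm_partition s p] = P [set w | rho w = p].

(** By invariance of the law, the probability of f is the mean over the values p
    of rho of the proportion of permutations s such that f holds at s p. *)
Lemma exchangeable_average (f : pred {set {set 'I_N}}) (delta : R) :
  (forall p, is_partition p ->
     #|[set s : {perm 'I_N} | f (perm_partition s p)]%SET|%:R <= (N`!)%:R * delta) ->
  (P [set w | f (rho w)] <= delta%:E)%E.
Proof.
move=> fd.
pose pr p : R := finite_law rho p.
have pr0 p : 0 <= pr p by exact: finite_law_ge0.
have pr_nopart p : ~~ is_partition p -> pr p = 0.
  move=> np; rewrite /pr /finite_law (_ : [set _ | _] = set0) ?measure0//.
  by apply/seteqP; split => w //= rp; rewrite -rp rho_part in np.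
have pr_tot : \sum_p pr p = 1 by exact: finite_law_total.
have pr_perm s p : pr (perm_partition s p) = pr p by rewrite /pr /finite_law rho_exch.
rewrite (finite_event_law rho_meas) lee_fin -/pr.
have shift (s : {perm 'I_N}) : \sum_(p | f p) pr p = \sum_p (f (perm_partition s p))%:R * pr p.
  rewrite big_mkcond /= (reindex (@perm_partition N s)) /=; last exact/onW_bij/perm_partition_bij.
  by apply: eq_bigr => p _; rewrite pr_perm; case: ifP; rewrite ?mul1r ?mul0r.
have NF0 : 0 < (N`!)%:R :> R by rewrite ltr0n fact_gt0.
rewrite -(ler_pM2l NF0).
have -> : (N`!)%:R * \sum_(p | f p) pr p = \sum_(s : {perm 'I_N}) \sum_(p | f p) pr p.
  by rewrite sumr_const -card_Sn mulr_natl.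
rewrite (eq_bigr _ (fun s _ => shift s)).
rewrite exchange_big /= -[leRHS]mulr1 -[X in _ <= _ * X]pr_tot mulr_sumr; apply: ler_sum => p _.
rewrite -mulr_suml; have [pp|np] := boolP (is_partition p); last first.
  by rewrite pr_nopart// !mulr0.
rewrite ler_wpM2r//; apply: le_trans (fd p pp).
rewrite -sum1dep_card natr_sum [leRHS]big_mkcond /=; apply: ler_sum => s _.
by case: ifP.
Qed.
End Averaging.

Section ExchangeableInduced.
Variables (T : eqType) (x : Omega -> nat -> T).
Hypothesis x_meas : forall n p, measurable [set w | induced_partition n (x w) = p].
Hypothesis x_exch : exchangeable P (fun n w => induced_partition n (x w)).

(** The bound of [captured_chebyshev] is of order 1 / #|p|.  The second
    condition makes it deterministic, and is invariant under permutations because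
    it only involves the number of blocks. *)
Lemma exchangeable_deviation (N : nat) (C : {set 'I_N}) (e : R) (M : nat) (c : R) :
  0 < e -> (0 < N)%N -> (0 < M)%N -> 0 < c ->
  let p w := induced_partition N (x w) in
  (P [set w | ((e * #|p w|%:R < `|(captured C (p w))%:R - mean_captured R C (p w)|) &&
              (c <= M%:R * #|p w|%:R))%R] <= (M%:R / (e ^+ 2 * c))%:E)%E.
Proof.
move=> e0 N0 M0 c0; set p := fun w => _.
pose f (p : {set {set 'I_N}}) := (e * #|p|%:R < `|(captured C p)%:R - mean_captured R C p|)
   && (c <= M%:R * #|p|%:R).
apply: (@exchangeable_average N p _ _ _ f) => [w|q|s q|q qp].
- exact: induced_partition_is.
- exact: x_meas.
- exact: x_exch.
have M0R : 0 < M%:R :> R by rewrite ltr0n.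
have [cq|cq] := leP c (M%:R * #|q|%:R); last first.
  rewrite (_ : [set s | _]%SET = finset.set0) ?cards0; last first.
    by apply/setP => s; rewrite !inE /f card_perm_partition [c <= _]leNgt cq andbF.
  have e20 : 0 < e ^+ 2 by rewrite exprn_gt0.
  by rewrite mulr_ge0// divr_ge0// ltW// mulr_gt0.
have q0 : 0 < #|q|%:R :> R by rewrite -(pmulr_rgt0 _ M0R) (lt_le_trans c0).
apply: le_trans (_ : (N`!)%:R / (e ^+ 2 * #|q|%:R) <= _).
  apply: le_trans (captured_chebyshev C e0 N0 qp); rewrite ler_nat subset_leq_card//.
  by apply/fintype.subsetP => s; rewrite !inE => /andP[].
rewrite ler_wpM2l// -[leLHS]mul1r ler_pdivrMr ?mulr_gt0 ?exprn_gt0//.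
rewrite mulrAC ler_pdivlMr ?mulr_gt0 ?exprn_gt0// mul1r mulrCA.
by rewrite ler_pM2l// exprn_gt0.
Qed.

(** The cutoff (j + 1)^2 <= M #|p j| makes the probabilities of deviation
    summable in j, and by [regular_growth] every path satisfies it for some M. *)
Lemma exchangeable_captured (q b : nat) (sigma : R) :
  (0 < q)%N -> (1 < b)%N -> 4 < (2 ^ q)%N%:R `^ sigma :> R ->
  {ae P, forall w, regular_at (fun n => #|induced_partition n (x w)|%:R) sigma} ->
  {ae P, forall w,
    let N j := (b * j.+1 ^ q)%N in
    let C j := [set i : 'I_(N j) | ((b - 1) * j.+1 ^ q <= i)%N]%SET in
    let p j := induced_partition (N j) (x w) in
    ((captured (C j) (p j))%:R - mean_captured R (C j) (p j)) / #|p j|%:R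
      @[j --> \oo] --> (0 : R)}.
Proof.
move=> q0 b1 q4 reg.
pose N j := (b * j.+1 ^ q)%N.
have N0 j : (0 < N j)%N by rewrite muln_gt0 expn_gt0/= andbT ltnW.
pose C j := [set i : 'I_(N j) | ((b - 1) * j.+1 ^ q <= i)%N]%SET.
pose p j w := induced_partition (N j) (x w).
pose dev j w : R := (captured (C j) (p j w))%:R - mean_captured R (C j) (p j w).
pose bad k M j := [set w | (k.+1%:R^-1 * #|p j w|%:R < `|dev j w|) &&
   ((j.+1 ^ 2)%:R <= M.+1%:R * #|p j w|%:R :> R)].
have bad_ev k M : {ae P, forall w, exists j0, forall j, (j0 <= j)%N -> ~ bad k M j w}.
  apply: (@borel_cantelli_quadratic _ (M.+1%:R / (k.+1%:R^-1 ^+ 2))).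
  - by rewrite divr_ge0.
  - move=> j; pose f (r : {set {set 'I_(N j)}}) :=
      (k.+1%:R^-1 * #|r|%:R < `|(captured (C j) r)%:R - mean_captured R (C j) r|) &&
      ((j.+1 ^ 2)%:R <= M.+1%:R * #|r|%:R :> R).
    exact: (finite_event_measurable (@x_meas (N j)) f).
  - move=> j; rewrite -mulrA -invfM.
    by apply: exchangeable_deviation.
have /ae_foralln bad_ev1 : forall k, {ae P, forall w, forall M, exists j0, forall j, (j0 <= j)%N -> ~ bad k M j w}.
  by move=> k; apply/ae_foralln.
move: reg bad_ev1; apply: filterS2 => w reg nbad /=.
have [M M0 HM] := regular_growth reg (card_induced_partition_natr_homo _ _)
  (card_induced_partition_natr_ge1 _ _) q0 (ltnW b1) q4.
apply/cvgr0Pnorm_le => e e0.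
pose k := Num.truncn (e^-1).
have ke : k.+1%:R^-1 <= e by exact: invr_truncnS_le.
have [j0 Hj0] := nbad k M.-1.
exists j0 => // j /= /Hj0 /negP; rewrite negb_and.
have -> /= : (j.+1 ^ 2)%:R <= M.-1.+1%:R * #|p j w|%:R :> R.
  rewrite prednK//; apply: le_trans (HM j.+1 isT).
  by rewrite ler_nat leq_exp2r.
rewrite orbF -leNgt => h.
have p0 : 0 < #|p j w|%:R :> R by rewrite ltr0n card_induced_partition_gt0.
rewrite normrM normfV (ger0_norm (ltW p0)) ler_pdivrMr//.
by apply: le_trans h _; rewrite ler_wpM2r// ltW.
Qed.
End ExchangeableInduced.
End AlmostSure.

(** * Block sizes of an exchangeable partition *)

(** Comparison of sampling without and with replacement: replacing the i-th
    factor by 1 / b costs at most i / (b m), and r^2 b^-(r-1) is bounded, which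
    makes the estimate uniform in r. *)
Lemma capture_prob_approx (R : realFieldType) (b m r : nat) : (1 < b)%N -> (0 < m)%N ->
  `|b%:R^-1 ^+ r - capture_prob R m (b * m) r| <= 4 / (b * m)%:R.
Proof.
move=> b1 m0.
pose N : R := (b * m)%:R; pose y : R := b%:R^-1.
have N0 : 0 < N by rewrite ltr0n muln_gt0 m0 andbT ltnW.
have b0 : 0 < b%:R :> R by rewrite ltr0n ltnW.
have y0 : 0 < y by rewrite invr_gt0.
have y12 : y <= 1 / 2.
  by rewrite mul1r lef_pV2 ?posrE// ler_nat.
have x_le i : 0 <= y - (m - i)%N%:R / (b * m - i)%N%:R <= i%:R / N.
  have [mi|im] := leqP m i.
    rewrite (_ : (m - i)%N = 0)%N; last lia.
    rewrite mul0r subr0 ltW//=.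
    have -> : y = m%:R / N by rewrite /y /N natrM invfM mulrCA divff ?mulr1// gt_eqF ?ltr0n.
    by rewrite ler_pM2r ?invr_gt0// ler_nat.
  have ibm : (i < b * m)%N by nia.
  have d0 : 0 < (b * m - i)%N%:R :> R by rewrite ltr0n subn_gt0.
  have -> : y - (m - i)%N%:R / (b * m - i)%N%:R =
     ((b - 1) * i)%N%:R / (b%:R * (b * m - i)%N%:R) :> R.
    move: d0; rewrite /y !natrB ?(ltnW im) ?(ltnW ibm)// => d0.
    rewrite !natrM natrB 1?ltnW//; field.
    by rewrite !gt_eqF// -natrM.
  rewrite divr_ge0//=.
  rewrite ler_pdivrMr ?mulr_gt0// mulrAC ler_pdivlMr// /N -!natrM ler_nat.
  have le1 : ((b - 1) * m <= b * m - i)%N by nia.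
  have le2 : ((b - 1) * i * (b * m) <= i * (b * (b * m - i)))%N.
    rewrite (_ : ((b - 1) * i * (b * m) = i * (b * ((b - 1) * m)))%N); last by ring.
    by rewrite !leq_mul.
  exact: le2.
have P0 i : 0 <= capture_prob R m (b * m) i by exact: capture_prob_ge0.
have key i : 0 <= y ^+ i - capture_prob R m (b * m) i <= (i * i)%N%:R * y ^+ i.-1 / N.
  elim: i => [|i /andP[IH1 IH2]].
    by rewrite /capture_prob big_ord0 subrr mul0r mul0r lexx.
  have /andP[h1 h2] := x_le i.
  have -> : y ^+ i.+1 - capture_prob R m (b * m) i.+1 =
     y * (y ^+ i - capture_prob R m (b * m) i) +
     capture_prob R m (b * m) i * (y - (m - i)%N%:R / (b * m - i)%N%:R).
    by rewrite /capture_prob big_ord_recr /= exprS; ring.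
  have Pi := P0 i.
  apply/andP; split; first by rewrite addr_ge0 ?mulr_ge0// ltW.
  have e1 : y * (y ^+ i - capture_prob R m (b * m) i) <= (i * i)%N%:R * y ^+ i / N.
    apply: le_trans (ler_wpM2l (ltW y0) IH2) _.
    case: (i) => [|k]; first by rewrite !(mul0r, mulr0).
    by rewrite /= exprS le_eqVlt; apply/orP; left; apply/eqP; ring.
  have e2 : capture_prob R m (b * m) i * (y - (m - i)%N%:R / (b * m - i)%N%:R)
     <= y ^+ i * (i%:R / N).
    by apply: ler_pM => //; rewrite -subr_ge0.
  apply: le_trans (lerD e1 e2) _.
  have -> : (i * i)%N%:R * y ^+ i / N + y ^+ i * (i%:R / N) = (i * i + i)%N%:R * (y ^+ i / N).
    by rewrite natrD; ring.
  rewrite /= -mulrA ler_wpM2r ?divr_ge0 ?exprn_ge0 ?(ltW y0) ?(ltW N0)//.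
  by rewrite ler_nat; nia.
have /andP[k1 k2] := key r; rewrite ger0_norm//; apply: le_trans k2 _.
rewrite ler_wpM2r ?invr_ge0 ?(ltW N0)//.
have sq k : (k * k <= 4 * 2 ^ k.-1)%N.
  case: k => // k; elim: k => // k IH; case: k IH => // k; case: k => // k IH.
  by rewrite /= expnS; move: IH; rewrite /=; nia.
apply: (@le_trans _ _ ((4 * 2 ^ r.-1)%N%:R * (1 / 2) ^+ r.-1)).
  by apply: ler_pM; rewrite ?exprn_ge0 ?ler_nat ?(ltW y0) ?lerXn2r// ?nnegrE ltW.
by rewrite natrM natrX -mulrA -exprMn mulrA mulr1 divff// expr1n mulr1.
Qed.

Section OnePath.
Variables (R : realType) (T : eqType) (x : nat -> T) (sigma : R) (q : nat).
Hypothesis sigma01 : 0 < sigma < 1.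
Hypothesis q0 : (0 < q)%N.

Let K n : R := #|induced_partition n x|%:R.
Hypothesis K_reg : regular_at K sigma.

Let N b j := (b * j.+1 ^ q)%N.

(** The number of captured blocks is K (b m) - K ((b - 1) m), whose ratio to
    K (b m) has a limit by regular variation, and its mean is close to the sum
    of the powers b^-#|B|. *)
Lemma pgf_along b : (1 < b)%N ->
  (let C j := [set i : 'I_(N b j) | ((b - 1) * j.+1 ^ q <= i)%N]%SET in
    let p j := induced_partition (N b j) x in
    ((captured (C j) (p j))%:R - mean_captured R (C j) (p j)) / #|p j|%:R
      @[j --> \oo] --> (0 : R)) ->
  (\sum_(B in induced_partition (N b j) x) b%:R^-1 ^+ #|B|) / K (N b j) @[j --> \oo]
    --> 1 - (1 - b%:R^-1) `^ sigma.
Proof.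
move=> b1 /=.
set C := fun j => [set i : 'I_(N b j) | ((b - 1) * j.+1 ^ q <= i)%N]%SET.
set p := fun j => induced_partition (N b j) x => dev0.
have b0 : (0 < b)%N by exact: ltnW.
have m0 j : (0 < j.+1 ^ q)%N by rewrite expn_gt0.
have N0 j : (0 < N b j)%N by rewrite muln_gt0 b0 m0.
have N_ge j : (j <= N b j)%N.
  rewrite /N; apply: leq_trans (leq_pmull _ b0); apply: leq_trans (leqnSn _) _.
  by rewrite -[X in (X <= _)%N]expn1 leq_pexp2l.
have K0 j : 0 < K (N b j) by rewrite ltr0n card_induced_partition_gt0.
have bR0 : 0 < b%:R :> R by rewrite ltr0n.
have cardC j : #|C j| = (j.+1 ^ q)%N.
  have -> : C j = ~: [set i : 'I_(N b j) | (i < (b - 1) * j.+1 ^ q)%N]%SET.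
    by apply/setP => i; rewrite !inE -leqNgt.
  have le1 : ((b - 1) * j.+1 ^ q <= N b j)%N by rewrite leq_mul2r leq_subr orbT.
  rewrite cardsCs finset.setCK card_ord -sum1dep_card -(big_ord_widen _ (fun=> 1%N) le1).
  by rewrite sum1_card card_ord /N -mulnBl subKn ?mul1n.
have cap : (captured (C j) (p j))%:R / K (N b j) @[j --> \oo] --> 1 - (1 - b%:R^-1) `^ sigma.
  have moo : (j.+1 ^ q)%N @[j --> \oo] --> \oo.
    move=> A [k _ kA]; exists k => // j /= kj; apply: kA => /=.
    apply: leq_trans kj _; apply: leq_trans (leqnSn _) _.
    by rewrite -[X in (X <= _)%N]expn1 leq_pexp2l.
  have bm0 : (0 < b - 1)%N by rewrite subn_gt0.
  have h := cvg_comp _ _ moo (K_reg bm0 b0).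
  have bE : (b - 1)%N%:R / b%:R = 1 - b%:R^-1 :> R.
    by rewrite natrB// mulrBl divff ?gt_eqF// mul1r.
  rewrite bE in h.
  apply: (eq_near_cvgB (cvg_cst (1 : R)) h); apply: nearW => j /=.
  have le1 : ((b - 1) * j.+1 ^ q <= N b j)%N by rewrite leq_mul2r leq_subr orbT.
  rewrite captured_induced// natrB; last exact: card_induced_partition_homo.
  by rewrite mulrBl -/(K _) divff// gt_eqF.
have mean : mean_captured R (C j) (p j) / K (N b j) @[j --> \oo] --> 1 - (1 - b%:R^-1) `^ sigma.
  rewrite -[X in _ --> X]subr0; apply: (eq_near_cvgB cap dev0); apply: nearW => j /=.
  by rewrite -mulrBl opprB addrCA subrr addr0.
have diff0 : (mean_captured R (C j) (p j) - \sum_(B in p j) b%:R^-1 ^+ #|B|) / K (N b j)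
    @[j --> \oo] --> (0 : R).
  have N4 : 4 / (N b j)%:R @[j --> \oo] --> (0 : R).
    apply/cvgr0Pnorm_le => e e0.
    near=> j; rewrite ger0_norm ?divr_ge0// ler_pdivrMr ?ltr0n// mulrC -ler_pdivrMr//.
    apply: (@le_trans _ _ j%:R); last by rewrite ler_nat; apply: leq_trans (N_ge j).
    by near: j; exact: nbhs_infty_ger.
  apply/cvgr0Pnorm_le => e e0.
  have /cvgr0Pnorm_le /(_ e e0) N4e := N4.
  near=> j; apply: (@le_trans _ _ `|4 / (N b j)%:R|); last by near: j; exact: N4e.
  rewrite normrM normfV (ger0_norm (ltW (K0 j))) ler_pdivrMr// -sumrB.
  apply: le_trans (ler_norm_sum _ _ _) _.
  apply: le_trans (_ : \sum_(B in p j) 4 / (N b j)%:R <= _).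
    by apply: ler_sum => B _; rewrite cardC distrC; exact: capture_prob_approx.
  by rewrite sumr_const -[leLHS]mulr_natr ler_wpM2r// ler_norm.
rewrite -[X in _ --> X]subr0; apply: (eq_near_cvgB mean diff0); apply: nearW => j /=.
by rewrite -mulrBl opprB addrCA subrr addr0.
Unshelve. all: by end_near. Qed.

(** The sum of 1 - b^-#|B| over the blocks is nondecreasing in n, so that the
    limit along the subsequence extends to all n. *)
Lemma pgf_all b : (1 < b)%N ->
  (let C j := [set i : 'I_(N b j) | ((b - 1) * j.+1 ^ q <= i)%N]%SET in
    let p j := induced_partition (N b j) x in
    ((captured (C j) (p j))%:R - mean_captured R (C j) (p j)) / #|p j|%:R
      @[j --> \oo] --> (0 : R)) ->
  (\sum_(B in induced_partition n x) b%:R^-1 ^+ #|B|) / K n @[n --> \oo]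
    --> 1 - (1 - b%:R^-1) `^ sigma.
Proof.
move=> b1 /(pgf_along b1) along.
have b0 : (0 < b)%N by exact: ltnW.
have [s0 s1] := andP sigma01.
have N0 j : (0 < N b j)%N by rewrite muln_gt0 b0 expn_gt0.
have K0 n : (0 < n)%N -> 0 < K n by move=> n0; rewrite ltr0n card_induced_partition_gt0.
have bR0 : 0 < b%:R :> R by rewrite ltr0n.
have Nh : {homo N b : i j / (i < j)%N}.
  by move=> i j ij; rewrite ltn_pmul2l// ltn_exp2r.
have y0 : 0 <= b%:R^-1 :> R by rewrite invr_ge0.
have y1 : b%:R^-1 <= 1 :> R by rewrite invf_le1// ler1n.
have Kh : {homo K : m n / (m <= n)%N >-> m <= n} by exact: card_induced_partition_natr_homo.
pose u n : R := \sum_(B in induced_partition n x) (1 - b%:R^-1 ^+ #|B|).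
have uE n : u n = K n - \sum_(B in induced_partition n x) b%:R^-1 ^+ #|B|.
  by rewrite /u sumrB sumr_const.
have ul : u n / K n @[n --> \oo] --> (1 - b%:R^-1) `^ sigma.
  apply: (@squeeze_subsequence _ u K (N b)) => //.
  - move=> n; apply: sumr_ge0 => B _; rewrite subr_ge0.
    by rewrite exprn_ile1.
  - move=> m n mn; apply: (@sum_induced_homo _ x R (fun r => 1 - b%:R^-1 ^+ r)) => //.
      by move=> i j ij; rewrite lerD2l lerN2 ler_wiXn2l.
    by move=> i; rewrite subr_ge0 exprn_ile1.
  - by move=> j; exact: K0.
  - rewrite -[X in _ --> X](subKr 1); apply: (eq_near_cvgB (cvg_cst (1 : R)) along); apply: nearW => j /=.
    by rewrite uE mulrBl divff// gt_eqF// K0.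
  - apply: (regular_ratio _ K_reg) => //; first by rewrite s0 ltW.
    exact: cvg_power_ratio.
apply: (eq_near_cvgB (cvg_cst (1 : R)) ul); near=> n.
rewrite /= uE mulrBl divff; first by rewrite opprB addrCA subrr addr0.
by rewrite gt_eqF// K0//; near: n; exact: nbhs_infty_gt.
Unshelve. all: by end_near. Qed.

Lemma block_size_ratio :
  (forall b, (1 < b)%N ->
   let C j := [set i : 'I_(N b j) | ((b - 1) * j.+1 ^ q <= i)%N]%SET in
    let p j := induced_partition (N b j) x in
    ((captured (C j) (p j))%:R - mean_captured R (C j) (p j)) / #|p j|%:R
      @[j --> \oo] --> (0 : R)) ->
  forall r, (0 < r)%N ->
  (num_blocks_of_size r (induced_partition n x))%:R / K n @[n --> \oo]
    --> - binom_coef sigma r.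
Proof.
move=> dev r r0.
pose p j : R := if j == 0 then 0 else - binom_coef sigma j.
have -> : - binom_coef sigma r = p r by rewrite /p gtn_eqF.
pose uu n j : R := (num_blocks_of_size j (induced_partition n x))%:R / K n.
pose g s := 1 - (1 - s) `^ sigma.
apply: (@pgf_inversion _ uu p g) => [n j|n|b b1|k].
- by rewrite divr_ge0.
- have E : \sum_(j < n.+1) (num_blocks_of_size j (induced_partition n x))%:R = K n.
    rewrite /K -sumr_const (sum_induced_by_size x (fun=> 1)).
    by apply: eq_bigr => j _; rewrite mulr1.
  rewrite -mulr_suml E; have [->|n0] := eqVneq (K n) 0; first by rewrite mul0r.
  by rewrite divff.
- have := pgf_all b1 (dev b b1); apply: eq_near_cvg; apply: nearW => n /=.
  rewrite (sum_induced_by_size x (fun k => b%:R^-1 ^+ k)) mulr_suml; apply: eq_bigr => j _.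
  by rewrite /uu mulrAC.
case: k => [|k].
  exists 1 => s /andP[h0 h1]; case/andP: sigma01 => sg0 _.
  rewrite big_ord0 subr0 mulr1 /g ger0_norm ?gerBl ?powR_ge0// subr_ge0.
  by have := @ge0_ler_powR R sigma (ltW sg0) (1 - s) 1; rewrite powR1 !nnegrE => -> //; lra.
have [C HC] := binom_expansion k.+1 sigma; exists C => s s01; apply: le_trans (HC s s01).
rewrite distrC le_eqVlt; apply/orP; left; apply/eqP; congr `|_|.
rewrite !big_ord_recl /= /p /= mul0r add0r /binom_coef big_ord0 expr0 mulr1 /g.
rewrite (eq_bigr (fun i : 'I_k => - (\prod_(i0 < bump 0 i) ((i0%:R - sigma) / i0.+1%:R) * s ^+ bump 0 i))).
  by rewrite sumrN; ring.
by move=> i _; rewrite mulNr.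
Qed.
End OnePath.

Theorem exchangeable_block_size_ratio (d : measure_display) (Omega : measurableType d)
    (R : realType) (P : probability Omega R) (T : eqType) (x : Omega -> nat -> T)
    (sigma : R) : 0 < sigma < 1 ->
  (forall n p, measurable [set w | induced_partition n (x w) = p]) ->
  exchangeable P (fun n w => induced_partition n (x w)) ->
  {ae P, forall w, regular_at (fun n => #|induced_partition n (x w)|%:R) sigma} ->
  forall r, (0 < r)%N ->
  {ae P, forall w,
    (num_blocks_of_size r (induced_partition n (x w)))%:R / #|induced_partition n (x w)|%:R
      @[n --> \oo] --> - binom_coef sigma r}.
Proof.
move=> s01 x_meas x_exch reg r r0.
have [q q0 q4] := @large_dyadic_power R sigma (proj1 (andP s01)).
have dev b : (1 < b)%N -> _ := fun b1 =>
  exchangeable_captured x_meas x_exch q0 b1 q4 reg.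
have {}dev : forall b, {ae P, forall w, (1 < b)%N ->
    let N j := (b * j.+1 ^ q)%N in
    let C j := [set i : 'I_(N j) | ((b - 1) * j.+1 ^ q <= i)%N]%SET in
    let p j := induced_partition (N j) (x w) in
    ((captured (C j) (p j))%:R - mean_captured R (C j) (p j)) / #|p j|%:R
      @[j --> \oo] --> (0 : R)}.
  move=> b; have [b1|b1] := ltnP 1 b; last by apply: aeW.
  by move: (dev b b1); apply: filterS.
move/ae_foralln : dev => dev; move: reg dev; apply: filterS2 => w reg dev.
exact: (block_size_ratio s01 q0 reg).
Qed.

(** * The Gamma function *)

Section GammaFunction.
Context {R : realType}.
Notation mu := (@lebesgue_measure R).

Definition gamma_fun (x t : R) : R := t `^ (x - 1) * expR (- t).

Definition gamma_integral (x : R) : \bar R :=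
  (\int[mu]_(t in `]0%R, +oo[) (gamma_fun x t)%:E)%E.

Lemma GammaE x : Gamma x = fine (gamma_integral x).
Proof. by []. Qed.

Lemma gamma_fun_ge0 x t : 0 <= gamma_fun x t.
Proof. by rewrite mulr_ge0 ?powR_ge0 ?expR_ge0. Qed.

Lemma is_derive_gamma_fun (x t : R) : 0 < t ->
  is_derive t 1 (gamma_fun (x + 1)) (x * gamma_fun x t - gamma_fun (x + 1) t).
Proof.
move=> t0.
have d1 : is_derive t 1 (fun t : R => expR (- t)) (expR (- t) * (-1)).
  exact: (@is_derive1_comp R (@expR R) (fun t : R => - t) t _ _ _ (is_deriveNid _ _)).
have := is_deriveM (is_derive1_powR x t0) d1.
have -> : (fun t : R => t `^ x) * (fun t : R => expR (- t)) = gamma_fun (x + 1).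
  by apply/funext => u; rewrite /gamma_fun addrK.
move=> h; apply: is_derive_eq; rewrite /gamma_fun addrK /GRing.scale /=; ring.
Qed.

Lemma continuous_gamma_fun (x t : R) : 0 < t -> {for t, continuous (gamma_fun x)}.
Proof.
move=> t0; apply/differentiable_continuous/derivable1_diffP.
by have [] := is_derive_gamma_fun (x - 1) t0; rewrite subrK.
Qed.

Lemma measurable_gamma_fun (x : R) : measurable_fun (`]0, +oo[ : set R) (gamma_fun x).
Proof.
apply: open_continuous_measurable_fun => //.
by move=> t /set_mem; rewrite /= in_itv/= => /andP[t0 _]; exact: continuous_gamma_fun.
Qed.

Let D (n : nat) : set R := `[n.+2%:R^-1, n.+2%:R].

Let n2_gt0 n : 0 < n.+2%:R :> R. Proof. by rewrite ltr0n. Qed.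
Let n2_lt n : n.+2%:R^-1 < n.+2%:R :> R.
Proof. by apply: (@lt_trans _ _ 1); rewrite ?invf_lt1// ltr1n. Qed.

Let D_gt0 n t : D n t -> 0 < t.
Proof. by rewrite /D /= in_itv/= => /andP[h _]; apply: lt_le_trans h; rewrite invr_gt0. Qed.

Let mD n : measurable (D n : set (measurableTypeR R)). Proof. exact: measurable_itv. Qed.

Let gamma_within x n : {within `[n.+2%:R^-1, n.+2%:R], continuous (gamma_fun x)}.
Proof.
apply: continuous_in_subspaceT => t; rewrite inE => /D_gt0.
exact: continuous_gamma_fun.
Qed.

Let gamma_integrable x n : mu.-integrable (D n) (EFin \o gamma_fun x).
Proof.
by apply: continuous_compact_integrable; [exact: segment_compact|exact: gamma_within].
Qed.

Let J n x : R := \int[mu]_(t in D n) gamma_fun x t.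

Let J_rec n x : x * J n x - J n (x + 1) =
  gamma_fun (x + 1) n.+2%:R - gamma_fun (x + 1) n.+2%:R^-1.
Proof.
have c : {within `[n.+2%:R^-1, n.+2%:R], continuous (fun t => x * gamma_fun x t - gamma_fun (x + 1) t)}.
  apply: continuous_in_subspaceT => t; rewrite inE => /D_gt0 t0.
  apply: cvgB; last exact: continuous_gamma_fun.
  by apply: cvgM; [exact: cvg_cst|exact: continuous_gamma_fun].
have oo (t : R) : t \in `]n.+2%:R^-1, n.+2%:R[ -> 0 < t.
  by rewrite in_itv/= => /andP[h _]; apply: lt_trans h; rewrite invr_gt0.
have := continuous_FTC2 (n2_lt n) c (F := gamma_fun (x + 1)).
rewrite -EFinB => h.
have int1 : mu.-integrable (D n) (EFin \o (fun t => x * gamma_fun x t)).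
  exact: (integrableZl (mD n) x (gamma_integrable x n)).
rewrite /J -(RintegralZl x (mD n) (gamma_integrable x n)).
rewrite -(RintegralB (mD n) int1 (gamma_integrable (x + 1) n)).
rewrite /Rintegral h //.
- split => [t /oo t0||].
  + by have [] := is_derive_gamma_fun x t0.
  + apply: cvg_at_right_filter; apply: continuous_gamma_fun; by rewrite invr_gt0.
  + by apply: cvg_at_left_filter; apply: continuous_gamma_fun.
- by move=> t /oo t0; rewrite derive1E; have [_ ->] := is_derive_gamma_fun x t0.
Qed.

Let bigcup_D : \bigcup_n D n = (`]0, +oo[%classic : set R).
Proof.
apply/seteqP; split => t.
  by move=> [n _ /D_gt0 t0]; rewrite /= in_itv/= andbT.
rewrite /= in_itv/= andbT => t0.
pose n := maxn (Num.truncn t) (Num.truncn t^-1).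
have lt_n (u : R) m : 0 < u -> (Num.truncn u <= m)%N -> u <= m.+2%:R.
  move=> u0 um; have /truncn_itv/andP[_ /ltW h] := ltW u0.
  by apply: le_trans h _; rewrite ler_nat; lia.
exists n => //; rewrite /D /= in_itv/=; apply/andP; split.
  have ti0 : 0 < t^-1 by rewrite invr_gt0.
  by rewrite -[leRHS]invrK lef_pV2 ?posrE// lt_n// /n leq_maxr.
by rewrite lt_n// /n leq_maxl.
Qed.

Let JE n x : (J n x)%:E = (\int[mu]_(t in D n) (gamma_fun x t)%:E)%E.
Proof.
rewrite /J /Rintegral fineK//; exact: (integrable_fin_num (mD n) (gamma_integrable x n)).
Qed.

Let J_cvg x : ((J n x)%:E @[n --> \oo] --> gamma_integral x)%E.
Proof.
under eq_fun do rewrite JE.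
rewrite /gamma_integral -bigcup_D; apply: ge0_nondecreasing_set_cvg_integral => //.
- move=> m n mn; apply/subsetPset => t; rewrite /D /= !in_itv/= => /andP[h1 h2].
  apply/andP; split; last by apply: le_trans h2 _; rewrite ler_nat.
  by apply: le_trans h1; rewrite lef_pV2 ?posrE// ler_nat.
- move=> n; apply/measurable_EFinP; apply: measurable_funS (measurable_gamma_fun x) => //.
  by move=> t /D_gt0; rewrite /= in_itv/= andbT.
- by move=> n t _; rewrite lee_fin gamma_fun_ge0.
Qed.

Let inv_n2_cvg0 : n.+2%:R^-1 @[n --> \oo] --> (0 : R).
Proof. by have := @cvg_harmonic R; rewrite -cvg_shiftS. Qed.

Let gamma_fun_infty x : 0 < x -> gamma_fun (x + 1) n.+2%:R @[n --> \oo] --> 0.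
Proof.
move=> x0; pose m := (Num.truncn x).+1.
have xm : x <= m%:R by have /truncn_itv/andP[_ /ltW] := ltW x0.
have bound n : gamma_fun (x + 1) n.+2%:R <= (m.+1`!)%:R / n.+2%:R.
  rewrite /gamma_fun addrK expRN ler_pdivrMr ?expR_gt0//.
  have h1 : n.+2%:R `^ x <= n.+2%:R ^+ m :> R.
    by rewrite -powR_mulrn// ler_powR// ler1n.
  have := expR_ge1Dxn m (ltW (n2_gt0 n)) => h2.
  apply: le_trans h1 _.
  apply: (@le_trans _ _ ((m.+1`!)%:R / n.+2%:R * (n.+2%:R ^+ m.+1 / (m.+1`!)%:R))).
    rewrite exprS le_eqVlt; apply/orP; left; apply/eqP; field.
    by rewrite !gt_eqF ?ltr0n ?fact_gt0.
  by rewrite ler_wpM2l ?divr_ge0//; apply: le_trans h2; rewrite lerDr.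
have h : (m.+1`!)%:R / n.+2%:R @[n --> \oo] --> (0 : R).
  by rewrite -[X in _ --> X](mulr0 (m.+1`!)%:R); apply: cvgM; [exact: cvg_cst|].
apply: (squeeze_cvgr _ (cvg_cst (0 : R)) h).
by apply: nearW => n; rewrite gamma_fun_ge0 bound.
Qed.

Let gamma_fun_zero x : 0 < x -> gamma_fun (x + 1) n.+2%:R^-1 @[n --> \oo] --> 0.
Proof.
move=> x0.
have right0 : n.+2%:R^-1 @[n --> \oo] --> (0 : R)^'+.
  move=> A /= /inv_n2_cvg0 [k _ kA]; exists k => // n /kA /=; apply.
  by rewrite invr_gt0.
apply: (squeeze_cvgr _ (cvg_cst (0 : R)) (cvg_comp _ _ right0 (powR_cvg0 x0))).
apply: nearW => n; rewrite gamma_fun_ge0 /gamma_fun addrK /= -[leRHS]mulr1.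
by rewrite ler_wpM2l ?powR_ge0// expR_le1 oppr_le0 invr_ge0.
Qed.

(** Integration by parts on the compact intervals [1/n, n], followed by monotone
    convergence. *)
Lemma gamma_integral_rec x : 0 < x ->
  (x%:E * gamma_integral x = gamma_integral (x + 1))%E.
Proof.
move=> x0.
have h1 : (((x * J n x)%:E) @[n --> \oo] --> x%:E * gamma_integral x)%E.
  under eq_fun do rewrite EFinM.
  by apply: cvgeZl => //; exact: J_cvg.
have h2 : (((x * J n x)%:E) @[n --> \oo] --> gamma_integral (x + 1) + 0)%E.
  have E n : (x * J n x)%:E = ((J n (x + 1))%:E +
     (gamma_fun (x + 1) n.+2%:R - gamma_fun (x + 1) n.+2%:R^-1)%:E)%E.
    by rewrite -J_rec -EFinD addrC subrK.
  under eq_fun do rewrite E.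
  apply: cvgeD; [by rewrite fin_num_adde_defl|exact: J_cvg|].
  rewrite -[0%E]/(0%:E) -[X in X%:E](subrr (0 : R)).
  apply: cvg_EFin; first exact: nearW.
  by apply: cvgB; [exact: gamma_fun_infty|exact: gamma_fun_zero].
by rewrite adde0 in h2; apply: (cvg_unique _ h1 h2).
Qed.

Lemma gamma_integral_ge0 x : (0 <= gamma_integral x)%E.
Proof. by apply: integral_ge0 => t _; rewrite lee_fin gamma_fun_ge0. Qed.

(** By the recursion it suffices to bound the integral at x + 1, and there
    t^x <= 1 + t compares it with the integrals at 1 and 2. *)
Lemma gamma_integral_fin x : 0 < x <= 1 -> gamma_integral x \is a fin_num.
Proof.
move=> /andP[x0 x1].
(* on compact intervals the recursion also holds at x = 0 *)
have one : (gamma_integral 1 <= 1)%E.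
  rewrite -(cvg_lim _ (@J_cvg 1))//; apply: lime_le; first exact: cvgP (@J_cvg 1).
  apply: nearW => n; rewrite lee_fin.
  have := J_rec n 0; rewrite mul0r !add0r /gamma_fun subrr !powRr0 !mul1r.
  have := expR_ge0 (- n.+2%:R : R).
  have : expR (- n.+2%:R^-1) <= 1 :> R by rewrite expR_le1 oppr_le0 invr_ge0.
  lra.
have two : (gamma_integral (1 + 1) <= 1)%E by rewrite -gamma_integral_rec// mul1e.
have x1fin : (gamma_integral (x + 1) <= 1 + 1)%E.
  apply: le_trans (leeD one two); rewrite /gamma_integral -ge0_integralD//.
  - apply: ge0_le_integral => //.
    + by move=> t _; rewrite lee_fin gamma_fun_ge0.
    + by apply/measurable_EFinP; exact: measurable_gamma_fun.
    + by apply: emeasurable_funD; apply/measurable_EFinP; exact: measurable_gamma_fun.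
    + move=> t; rewrite /= in_itv/= andbT => t0.
      rewrite -EFinD lee_fin /gamma_fun -mulrDl ler_wpM2r ?expR_ge0//.
      rewrite subrr powRr0 !addrK powRr1 ?(ltW t0)//.
      have [t1|t1] := leP t 1.
        apply: (@le_trans _ _ 1); last by rewrite lerDl ltW.
        by have := @ge0_ler_powR R x (ltW x0) t 1; rewrite powR1 !nnegrE => -> //; exact: ltW.
      apply: (@le_trans _ _ t); last by rewrite lerDr.
      by apply: ler1_powR => //; exact: ltW.
  - by move=> t _; rewrite lee_fin gamma_fun_ge0.
  - by apply/measurable_EFinP; exact: measurable_gamma_fun.
  - by move=> t _; rewrite lee_fin gamma_fun_ge0.
  - by apply/measurable_EFinP; exact: measurable_gamma_fun.
move: x1fin (gamma_integral_ge0 x); rewrite -gamma_integral_rec//.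
by case: (gamma_integral x) => //=; rewrite gt0_muley// lte_fin.
Qed.

Lemma gamma_integral_gt0 x : x <= 1 -> (0 < gamma_integral x)%E.
Proof.
move=> x1.
have sub : (`]0, 1]%classic : set R) `<=` `]0, +oo[%classic.
  by move=> t /=; rewrite !in_itv/= andbT => /andP[].
apply: (@lt_le_trans _ _ (\int[mu]_(t in `]0%R, 1%R]) (expR (-1))%:E)%E).
  rewrite integral_cst//= lebesgue_measure_itv/= lte_fin ltr01 sube0 mule1.
  by rewrite lte_fin expR_gt0.
apply: (@le_trans _ _ (\int[mu]_(t in `]0%R, 1%R]) (gamma_fun x t)%:E)%E).
  apply: ge0_le_integral => //.
  - apply/measurable_EFinP; apply: measurable_funS (measurable_gamma_fun x) => //.
  - move=> t; rewrite /= in_itv/= => /andP[t0 t1]; rewrite lee_fin /gamma_fun.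
    rewrite -[leLHS]mul1r ler_pM ?expR_ge0 ?ler_expR ?lerN2//.
    rewrite -[leLHS](powRr0 t); apply: ger_powR; first by rewrite t0.
    by rewrite subr_le0.
apply: ge0_subset_integral => //.
- by apply/measurable_EFinP; exact: measurable_gamma_fun.
- by move=> t _; rewrite lee_fin gamma_fun_ge0.
Qed.

Lemma Gamma_gt0 (x : R) : 0 < x <= 1 -> 0 < Gamma x.
Proof.
move=> x01; rewrite GammaE fine_gt0// gamma_integral_gt0; last by case/andP: x01.
by rewrite -ge0_fin_numE ?gamma_integral_ge0// gamma_integral_fin.
Qed.

(** If the integral is infinite at x it is so at x + 1, and both sides vanish
    since fine sends infinity to 0. *)
Lemma GammaD1 (x : R) : 0 < x -> Gamma (x + 1) = x * Gamma x.
Proof.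
move=> x0; rewrite !GammaE -gamma_integral_rec//.
case: (gamma_integral x) (gamma_integral_ge0 x) => //= _.
by rewrite gt0_muley ?lte_fin//= mulr0.
Qed.

Lemma Gamma_binom_coef (sigma : R) r : 0 < sigma < 1 -> (0 < r)%N ->
  - binom_coef sigma r = sigma * Gamma (r%:R - sigma) / (Gamma (1 - sigma) * (r`!)%:R).
Proof.
move=> /andP[s0 s1]; case: r => // r _.
have G0 : 0 < Gamma (1 - sigma) by apply: Gamma_gt0; lra.
elim: r => [|r IH].
  rewrite /binom_coef big_ord_recl big_ord0 /= -[1%:R - sigma]/(1 - sigma).
  by rewrite -[(1`!)%N]/1%N; field; rewrite gt_eqF.
rewrite /binom_coef big_ord_recr /= -/(binom_coef _ _) -mulNr IH.
have -> : r.+2%:R - sigma = r.+1%:R - sigma + 1 by rewrite -[r.+2%:R]natr1; ring.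
rewrite GammaD1; last by rewrite -[r.+1%:R]natr1; have := ler0n R r; lra.
rewrite [(r.+2`!)%N]factS natrM; field.
by rewrite !gt_eqF ?ltr0n ?fact_gt0.
Qed.
End GammaFunction.

(** * A strong law for indicators *)

Section LawOfLargeNumbers.
Context {d : measure_display} {Omega : measurableType d} {R : realType}.
Variables (P : probability Omega R) (E : nat -> set Omega) (p : R).
Hypothesis mE : forall i, measurable (E i).
Hypothesis PE : forall i, P (E i) = p%:E.
Hypothesis PEE : forall i j, i != j -> P (E i `&` E j) = (p * p)%:E.

Let rho m w : {set 'I_m} := [set i : 'I_m | w \in E i]%SET.

Let rho_meas m (S : {set 'I_m}) : measurable [set w | rho m w = S].
Proof.
rewrite (_ : [set w | _] = \bigcap_(i in [set: 'I_m]) (if i \in S then E i else ~` E i)).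
  apply: fin_bigcap_measurable => [|i _]; first exact: finite_finset.
  by case: ifP => _ //; exact: measurableC.
apply/seteqP; split => w /=.
  move=> <- i _ /=; rewrite inE; case: ifPn; first by move/set_mem.
  by move=> h Ew; move/negP: h; apply; exact: mem_set.
move=> h; apply/setP => i; rewrite inE; have := h i I; case: ifP => iS.
  by move=> /mem_set ->.
by move=> nE; apply/negbTE/negP => /set_mem.
Qed.

(** Chebyshev's inequality, written as a finite sum over the possible values of
    the set of indices of the events that occur. *)
Lemma count_deviation m (e : R) : 0 < e -> (0 < m)%N ->
  (P [set w | (e * m%:R < `|#|rho m w|%:R - m%:R * p|)%R] <= (1 / (e ^+ 2 * m%:R))%:E)%E.
Proof.
move=> e0 m0.
pose pr S : R := finite_law P (rho m) S.
have pr0 S : 0 <= pr S by exact: finite_law_ge0.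
have pr_sum (g : pred {set 'I_m}) : P [set w | g (rho m w)] = (\sum_(S | g S) pr S)%:E.
  exact: finite_event_law (@rho_meas m) g.
have pr_tot : \sum_S pr S = 1 by exact: finite_law_total (@rho_meas m).
have pr_sum1 (g : pred {set 'I_m}) : \sum_S pr S * (g S)%:R = \sum_(S | g S) pr S.
  by rewrite [RHS]big_mkcond; apply: eq_bigr => S _; case: ifP; rewrite ?mulr1 ?mulr0.
have pr1 i : \sum_S pr S * (i \in S)%:R = p.
  have := pr_sum (fun S => i \in S); rewrite (_ : [set _ | _] = E i).
    by rewrite PE pr_sum1 => -[].
  by apply/seteqP; split => w /=; rewrite inE; [move/set_mem|move/mem_set].
have pr2 i j : i != j -> \sum_S pr S * ((i \in S) && (j \in S))%:R = p * p.
  move=> ij; have := pr_sum (fun S => (i \in S) && (j \in S)).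
  rewrite (_ : [set _ | _] = E i `&` E j).
    by rewrite PEE// (pr_sum1 (fun S => (i \in S) && (j \in S))) => -[].
  apply/seteqP; split => w /=; rewrite !inE.
    by move=> /andP[/set_mem ? /set_mem].
  by move=> [? ?]; apply/andP; split; apply: mem_set.
have cov i j : \sum_S pr S * (((i \in S)%:R - p) * ((j \in S)%:R - p)) =
    if i == j then p - p * p else 0.
  rewrite (eq_bigr (fun S => pr S * ((i \in S) && (j \in S))%:R
     - p * (pr S * (i \in S)%:R) - p * (pr S * (j \in S)%:R) + p * p * pr S)).
    rewrite big_split /= !sumrB -!mulr_sumr !pr1 pr_tot.
    case: eqVneq => [->|ij]; last by rewrite pr2//; ring.
    rewrite (eq_bigr (fun S => pr S * (j \in S)%:R)); first by rewrite pr1; ring.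
    by move=> S _; rewrite andbb.
  by move=> S _; rewrite -mulnb natrM; ring.
have var : \sum_S pr S * (#|S|%:R - m%:R * p) ^+ 2 <= m%:R.
  rewrite (eq_bigr (fun S => \sum_i \sum_j pr S * (((i \in S)%:R - p) * ((j \in S)%:R - p)))).
    rewrite exchange_big /=.
    rewrite (eq_bigr (fun i => p - p * p)).
      rewrite sumr_const card_ord -[leLHS]mulr_natl -[leRHS]mulr1 ler_wpM2l//.
      by have := sqr_ge0 (p - 1 / 2); nra.
    move=> i _; rewrite exchange_big /= (eq_bigr _ (fun j _ => cov i j)).
    by rewrite (bigD1 i)//= eqxx big1 ?addr0// => j; rewrite eq_sym => /negbTE ->.
  move=> S _; rewrite (_ : #|S|%:R - m%:R * p = \sum_(i < m) ((i \in S)%:R - p)).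
    rewrite expr2 mulr_suml mulr_sumr; apply: eq_bigr => i _.
    by rewrite mulr_sumr mulr_sumr.
  rewrite sumrB sumr_const card_ord mulr_natl -sum1_card natr_sum big_mkcond /=.
  by congr (_ - _); apply: eq_bigr => i _; case: ifP.
rewrite (pr_sum (fun S => e * m%:R < `|#|S|%:R - m%:R * p|)) lee_fin.
have em0 : 0 < (e * m%:R) ^+ 2 by rewrite exprn_gt0// mulr_gt0// ltr0n.
have mR0 : 0 < m%:R :> R by rewrite ltr0n.
have -> : 1 / (e ^+ 2 * m%:R) = m%:R / (e * m%:R) ^+ 2 :> R by field; rewrite !gt_eqF.
rewrite ler_pdivlMr//; apply: le_trans var; rewrite mulr_suml big_mkcond /=.
apply: ler_sum => S _; case: ifP => [h|_]; last by rewrite mulr_ge0// sqr_ge0.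
rewrite ler_wpM2l// -[leRHS]real_normK ?num_real// lerXn2r ?nnegrE//; last exact: ltW.
by rewrite mulr_ge0// ltW.
Qed.

(** Pairwise independence gives summable deviation probabilities along the
    squares; the other n follow by monotonicity of the counts. *)
Lemma strong_law_indicators :
  {ae P, forall w, (\sum_(i < n) (w \in E i)%:R) / n%:R @[n --> \oo] --> p}.
Proof.
have card_rho m w : #|rho m w|%:R = \sum_(i < m) (w \in E i)%:R :> R.
  rewrite -sum1dep_card natr_sum big_mkcond /=; apply: eq_bigr => i _.
  by case: ifP.
pose bad k j := [set w | (k.+1%:R^-1 * (j.+1 ^ 2)%N%:R <
   `|#|rho (j.+1 ^ 2) w|%:R - (j.+1 ^ 2)%N%:R * p|)%R].
have bad_ev k : {ae P, forall w, exists j0, forall j, (j0 <= j)%N -> ~ bad k j w}.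
  apply: (@borel_cantelli_quadratic _ _ _ P _ (1 / (k.+1%:R^-1 ^+ 2))).
  - by rewrite divr_ge0.
  - move=> j; exact: (finite_event_measurable (@rho_meas (j.+1 ^ 2))
      (fun S => k.+1%:R^-1 * (j.+1 ^ 2)%N%:R < `|#|S|%:R - (j.+1 ^ 2)%N%:R * p|)).
  - move=> j; rewrite -mulrA -invfM; apply: count_deviation => //.
move/ae_foralln : bad_ev; apply: filterS => w nbad.
apply: (@squeeze_subsequence _ (fun n => \sum_(i < n) (w \in E i)%:R) (fun n => n%:R)
  (fun j => (1 * j.+1 ^ 2)%N)).
- by move=> n; apply: sumr_ge0.
- move=> a b ab; rewrite (big_ord_widen _ (fun i => (w \in E i)%:R) ab).
  by rewrite [leLHS]big_mkcond; apply: ler_sum => i _; case: ifP.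
- by move=> a b ab; rewrite ler_nat.
- by move=> j; rewrite mul1n ltr0n expn_gt0.
- by move=> i j ij; rewrite !mul1n ltn_exp2r.
- apply/cvgrPdist_le => e e0.
  pose k := Num.truncn (e^-1).
  have ke : k.+1%:R^-1 <= e by exact: invr_truncnS_le.
  have [j0 Hj0] := nbad k; exists j0 => // j /= /Hj0 /negP.
  rewrite -leNgt card_rho mul1n => h.
  have m0 : 0 < (j.+1 ^ 2)%N%:R :> R by rewrite ltr0n expn_gt0.
  have m1 : (j.+1 ^ 2)%N%:R != 0 :> R by rewrite gt_eqF.
  rewrite distrC -[X in _ - X](mulfK m1) -mulrBl normrM normfV (ger0_norm (ltW m0)).
  rewrite ler_pdivrMr//; apply: le_trans (_ : k.+1%:R^-1 * (j.+1 ^ 2)%N%:R <= _).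
    by rewrite [p * _]mulrC.
  by rewrite ler_wpM2r// ltW.
- exact: cvg_power_ratio.
Qed.
End LawOfLargeNumbers.

(** * Distinct values in an i.i.d. sample *)

(** The balls of radii 1 / (m + 1) around the points of a countable dense set.
    They make singletons, the diagonal and coincidences of labels measurable. *)
Lemma polish_separating (R : realType) (X : ptopologicalType) : polish R X ->
  exists U : nat -> set X, (forall k, open (U k)) /\
    forall x y, x <> y -> exists k, U k x /\ ~ U k y.
Proof.
move=> [[D cD dD] [dist [d0 dC dT dN _]]].
have dge0 x y : 0 <= dist x y.
  have h := dT x y x; have := (d0 x x).2 erefl; rewrite (dC y x) in h; lra.
have ball_open c e : open [set y | dist c y < e].
  rewrite openE => y /= ye; apply/dN; exists (e - dist c y); first by rewrite subr_gt0.
  by move=> z /= yz; have := dT c y z; lra.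
have [D0|[f]] := pfcard_geP cD.
  have [z []] := dD setT ltac:(by exists point) openT.
  by rewrite D0.
pose U k := if (choice.unpickle k : option (nat * nat)) is Some (n, m) then [set y | dist (f n) y < m.+1%:R^-1] else set0.
exists U; split=> [k|x y xy].
  by rewrite /U; case: choice.unpickle => [[n m]|]; [exact: ball_open|exact: open0].
have xy0 : 0 < dist x y.
  by rewrite lt_neqAle dge0 andbT; apply/eqP => /esym /d0.
pose m := Num.truncn (dist x y / 2)^-1.
have hm : m.+1%:R^-1 <= dist x y / 2 by apply: invr_truncnS_le; rewrite divr_gt0.
have m0 : 0 < m.+1%:R^-1 :> R by rewrite invr_gt0.
have [c [/= xc Dc]] : ([set y | dist x y < m.+1%:R^-1] `&` D) !=set0.
  apply: dD => //; exists x => /=.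
  by rewrite ((d0 x x).2 erefl).
have [n _ fn] : (f @` [set: nat]) c by exact: surj.
exists (choice.pickle (n, m)); rewrite /U choice.pickleK /= fn; split; first by rewrite dC.
by apply/negP; rewrite -leNgt; move: (dT x c y) (lt_le_trans xc hm); move: hm; set r := _^-1; lra.
Qed.

Section IIDLabels.
Context {d : measure_display} {Omega : measurableType d} {R : realType}.
Variable P : probability Omega R.
Variables (X : ptopologicalType) (H : probability (borel X) R).
Variable Z : nat -> {RV P >-> borel X}.
Hypothesis Z_law : forall n (A : set (borel X)), measurable A ->
     distribution P (Z n) A = H A.
Hypothesis Z_indep : mutually_independent Z.
Variable U : nat -> set X.
Hypothesis U_open : forall k, open (U k).
Hypothesis U_sep : forall x y, x <> y -> exists k, U k x /\ ~ U k y.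

Let mU k : measurable (U k : set (borel X)).
Proof. exact: sub_sigma_algebra. Qed.

Lemma borel_set1 (x : borel X) : measurable [set x].
Proof.
rewrite (_ : [set x] = \bigcap_(k in [set k | U k x]) (U k : set (borel X))).
  by apply: bigcap_measurableType => k _; exact: mU.
apply/seteqP; split=> y /=; first by move=> -> k.
move=> h; apply: contrapT => /nesym /U_sep [k [Ux nUy]].
by apply: nUy; exact: h.
Qed.

Lemma Z_prob n (A : set (borel X)) : measurable A -> P (Z n @^-1` A) = H A.
Proof. exact: Z_law. Qed.

Lemma Z_prob2 i j (A B : set (borel X)) : i != j -> measurable A -> measurable B ->
  P (Z i @^-1` A `&` Z j @^-1` B) = (H A * H B)%E.
Proof.
move=> ij mA mB; have ji : j == i = false by rewrite eq_sym (negbTE ij).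
pose F k := if k == i then A else B.
have := Z_indep (s := [:: i; j]) (A := F).
rewrite /= inE ij => /(_ isT).
rewrite big_cons big_seq1 /F eqxx ji !Z_prob// => <-; last first.
  by move=> k; case: ifP.
congr (P _); apply/seteqP; split => w /=.
  by move=> [Aw Bw] k; rewrite /= !inE => /orP[] /eqP ->; rewrite ?eqxx ?ji.
move=> h; split.
  by have := h i; rewrite /= !inE eqxx; apply.
by have := h j; rewrite /= !inE eqxx orbT ji; apply.
Qed.

Definition atoms_above (k : nat) : set (borel X) :=
  [set x | (k.+1%:R^-1%:E <= H [set x])%E].

Lemma atoms_above_finite k : finite_set (atoms_above k).
Proof.
apply: contrapT => /(infinite_set_fset k.+2) [B BA kB].
have mB : measurable [set` B].
  apply: countable_measurable; first exact: borel_set1.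
  exact/finite_set_countable/finite_fset.
have HB : H [set` B] = (\sum_(x <- B) H [set x])%E.
  rewrite -measure_fbigsetU.
  - congr (H _); apply/seteqP; split=> x /=.
      by move=> xB; rewrite -bigcup_fset; exists x.
    by rewrite -bigcup_fset => -[y /= yB ->].
  - by move=> x _; exact: borel_set1.
  - by move=> x y _ _ [z [/= -> ->]].
have : (H [set` B] <= 1)%E by exact: probability_le1.
apply/negP; rewrite -ltNge HB.
apply: (@lt_le_trans _ _ (\sum_(x <- B) (k.+1%:R^-1 : R)%:E)%E).
  rewrite sumEFin lte_fin big_const_seq count_predT iter_addr_0.
  rewrite -[ltRHS]mulr_natl ltr_pdivlMr ?ltr0n// mul1r ltr_nat.
  exact: kB.
by rewrite big_seq [leRHS]big_seq; apply: lee_sum => x /BA.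
Qed.

Lemma atoms_above_measurable k : measurable (atoms_above k).
Proof.
apply: countable_measurable; first exact: borel_set1.
exact/finite_set_countable/atoms_above_finite.
Qed.

Lemma atoms_bigcup : atoms H = \bigcup_k atoms_above k.
Proof.
apply/seteqP; split => x; rewrite /atoms /atoms_above /=.
  move=> Hx; have fx : H [set x] \is a fin_num by apply: fin_num_measure; exact: borel_set1.
  have fx0 : 0 < fine (H [set x]) by rewrite fine_gt0// Hx ltey_eq fx.
  exists (Num.truncn (fine (H [set x]))^-1) => //=.
  by rewrite -[leRHS]fineK// lee_fin; exact: invr_truncnS_le.
by move=> [k _]; apply: lt_le_trans; rewrite lte_fin invr_gt0.
Qed.

Lemma measurable_atoms : measurable (atoms H).
Proof.
by rewrite atoms_bigcup; apply: bigcup_measurable => k _; exact: atoms_above_measurable.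
Qed.

Lemma atoms_above_cvg :
  fine (H (atoms_above k)) @[k --> \oo] --> atomic_mass H.
Proof.
apply: fine_cvg; rewrite fineK; last by apply: fin_num_measure; exact: measurable_atoms.
rewrite atoms_bigcup; apply: nondecreasing_cvg_mu.
- exact: atoms_above_measurable.
- by rewrite -atoms_bigcup; exact: measurable_atoms.
- move=> k k' kk'; apply/subsetPset => x /=; apply: le_trans.
  by rewrite lee_fin lef_pV2 ?posrE ?ltr0n// ler_nat.
Qed.

(** The complement is the countable union of the rectangles formed by U k and
    its complement. *)
Lemma measurable_diagonal :
  measurable [set xy : borel X * borel X | xy.1 = xy.2].
Proof.
rewrite (_ : [set _ | _] = ~` \bigcup_k ((U k : set (borel X)) `*` ~` U k)).
  apply: measurableC; apply: bigcup_measurable => k _.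
  by apply: measurableX; [exact: mU|apply: measurableC; exact: mU].
apply/seteqP; split=> -[x y] /=.
  by move=> -> [k _ []].
move=> h; apply: contrapT => /U_sep [k [Ux nUy]].
by apply: h; exists k.
Qed.

(** By Fubini, the product law gives the part of the diagonal outside the atoms
    the integral of H {x} over the points x that are not atoms. *)
Lemma nonatoms_distinct i j : i != j ->
  {ae P, forall w, ~ (Z i w = Z j w /\ ~ atoms H (Z i w))}.
Proof.
move=> ij.
pose D := [set xy : borel X * borel X | xy.1 = xy.2] `&` (~` atoms H `*` setT).
have mD : measurable D.
  apply: measurableI; first exact: measurable_diagonal.
  by apply: measurableX => //; apply: measurableC; exact: measurable_atoms.
pose F w := (Z i w, Z j w).
have mF : measurable_fun setT F by apply: measurable_fun_pair; exact: measurable_funPT.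
pose FF : {mfun Omega >-> (borel X * borel X)%type} := mfun_Sub (mem_set mF).
exists (F @^-1` D); split; first by rewrite -[X in measurable X]setTI; exact (mF measurableT D mD).
  rewrite -[LHS]/(distribution P FF D) -(@product_measure_unique _ _ _ _ _ H H _ _ D mD).
    rewrite /product_measure1; apply: integral0_eq => x _ /=.
    have [ax|nax] := pselect (atoms H x).
      rewrite (_ : xsection D x = set0) ?measure0//.
      by apply/seteqP; split => y // /xsectionP [_ []].
    rewrite (_ : xsection D x = [set x]).
      by apply/eqP; rewrite -measure_le0 leNgt; apply/negP.
    apply/seteqP; split => y /=; first by move=> /xsectionP [/= -> _].
    by move=> ->; apply/xsectionP; split.
  by move=> A B mA mB; rewrite /distribution /pushforward; exact: Z_prob2.
by move=> w /= /contrapT[e na]; split => //; split.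
Qed.

Lemma frequency_outside (A : set (borel X)) : measurable A ->
  {ae P, forall w, (\sum_(i < n) (Z i w \notin A)%:R) / n%:R @[n --> \oo] --> 1 - fine (H A)}.
Proof.
move=> mA; pose p : R := 1 - fine (H A).
have HA : H (~` A) = p%:E.
  by rewrite probability_setC// /p EFinB fineK// fin_num_measure.
have mcA : measurable (~` A) by exact: measurableC.
have inE' w i : (w \in Z i @^-1` ~` A) = (Z i w \notin A).
  by rewrite -[LHS]/(Z i w \in ~` A) in_setC.
have h := @strong_law_indicators _ _ _ P (fun i => Z i @^-1` (~` A)) p.
apply: filterS (h _ _ _) => [w|i|i|i j ij].
- by under eq_fun do under eq_bigr do rewrite inE'.
- by rewrite -[X in measurable X]setTI; exact: measurable_funPT.
- by rewrite Z_prob.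
- by rewrite Z_prob2// HA -EFinM.
Qed.

Lemma card_induced_le_outside (x : nat -> borel X) (A : set (borel X)) n : finite_set A ->
  (#|induced_partition n x|%:R : R) <=
    \sum_(i < n) (x i \notin A)%:R + #|` fset_set A|%:R.
Proof.
move=> fA; rewrite card_induced_partition natr_sum.
have -> : \sum_(i < n) (new_value x i)%:R =
   \sum_(i < n) (new_value x i && (x i \notin A))%:R +
   \sum_(i < n) (new_value x i && (x i \in A))%:R :> R.
  rewrite -big_split; apply: eq_bigr => i _ /=.
  by case: (new_value x i); case: (x i \in A) => //=; rewrite ?addr0 ?add0r.
apply: lerD.
  by apply: ler_sum => i _; rewrite ler_nat; case: (new_value x i).
rewrite -natr_sum ler_nat.
pose new_in (i : 'I_n) := new_value x i && (x i \in A).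
pose s := [seq x (nat_of_ord i) | i <- enum 'I_n & new_in i].
have -> : (\sum_(i < n) (new_value x i && (x i \in A)) = size s)%N.
  rewrite size_map size_filter -sum1_count big_enum_cond /= [RHS]big_mkcond /=.
  by apply: eq_bigr => i _; rewrite /new_in; case: (_ && _).
apply: uniq_leq_size; last first.
  by move=> _ /mapP[i + ->]; rewrite mem_filter in_fset_set// => /andP[/andP[]].
rewrite map_inj_in_uniq; first by apply: filter_uniq; exact: enum_uniq.
move=> i j.
rewrite !mem_filter => /andP[/andP[ni _] _] /andP[/andP[nj _] _] e.
by apply: val_inj; exact: new_value_inj e.
Qed.

(** From below, values that are not atoms are pairwise distinct and have
    frequency 1 - a.  From above, the values outside finitely many atoms of mass
    close to a have a frequency close to 1 - a, and these atoms add only a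
    bounded number of values. *)
Lemma distinct_values_ratio :
  {ae P, forall w, (#|induced_partition n (fun i => Z i w)|%:R : R) / n%:R
     @[n --> \oo] --> 1 - atomic_mass H}.
Proof.
have ndist : {ae P, forall w, forall i j, i != j -> ~ (Z i w = Z j w /\ ~ atoms H (Z i w))}.
  apply/ae_foralln => i; apply/ae_foralln => j.
  have [->|ij] := eqVneq i j; first by apply: aeW.
  by apply: filterS (nonatoms_distinct ij).
have upper : {ae P, forall w, forall k, (\sum_(i < n) (Z i w \notin atoms_above k)%:R) / n%:R
   @[n --> \oo] --> 1 - fine (H (atoms_above k))}.
  by apply/ae_foralln => k; apply: frequency_outside; exact: atoms_above_measurable.
have lower := frequency_outside measurable_atoms.
move: ndist upper lower; apply: filterS3 => w ndist upper lower.
apply/cvgrPdist_le => e e0.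
have e3 : 0 < e / 3 by rewrite divr_gt0.
have [k _ Hk] : \forall k \near \oo, `|atomic_mass H - fine (H (atoms_above k))| <= e / 3.
  by have /cvgrPdist_le/(_ _ e3) := atoms_above_cvg.
have {}Hk := Hk k (leqnn k).
have /cvgrPdist_le/(_ _ e3) low := lower.
have /cvgrPdist_le/(_ _ e3) up := upper k.
pose J := #|` fset_set (atoms_above k)|.
near=> n.
have n0 : 0 < n%:R :> R by rewrite ltr0n; near: n; exact: nbhs_infty_gt.
have Jn : J%:R / n%:R <= e / 3.
  rewrite ler_pdivrMr// mulrC -ler_pdivrMr//; near: n; exact: nbhs_infty_ger.
have lown : `|1 - fine (H (atoms H)) - (\sum_(i < n) (Z i w \notin atoms H)%:R) / n%:R| <= e / 3.
  by near: n; exact: low.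
have upn : `|1 - fine (H (atoms_above k)) - (\sum_(i < n) (Z i w \notin atoms_above k)%:R) / n%:R| <= e / 3.
  by near: n; exact: up.
have le1 := card_induced_le_outside (fun i => Z i w) n (atoms_above_finite k).
have le2 : \sum_(i < n) (Z i w \notin atoms H)%:R <= #|induced_partition n (fun i => Z i w)|%:R :> R.
  rewrite card_induced_partition natr_sum; apply: ler_sum => i _; rewrite ler_nat.
  case: (boolP (Z i w \in atoms H)) => //= na; rewrite lt0b.
  apply/new_valueP => j ji; apply/eqP => ji_eq.
  apply: (ndist i j); first by rewrite gtn_eqF.
  by split => // ai; move/negP: na; apply; exact: mem_set.
have {}le1 : (#|induced_partition n (fun i => Z i w)|%:R : R) / n%:R <=
   (\sum_(i < n) (Z i w \notin atoms_above k)%:R) / n%:R + J%:R / n%:R.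
  by rewrite -mulrDl ler_pM2r ?invr_gt0.
have {}le2 : (\sum_(i < n) (Z i w \notin atoms H)%:R) / n%:R <=
   (#|induced_partition n (fun i => Z i w)|%:R : R) / n%:R.
  by rewrite ler_pM2r ?invr_gt0.
move: Hk lown upn le1 le2 Jn; rewrite /atomic_mass.
move=> /ler_normlP[? ?] /ler_normlP[? ?] /ler_normlP[? ?] ? ? ?.
by apply/ler_normlP; split; lra.
Unshelve. all: by end_near. Qed.

End IIDLabels.

(** * Partitions obtained by merging blocks with i.i.d. labels *)

Section ExchangeableLabels.
Context {d : measure_display} {Omega : measurableType d} {R : realType}.
Variable P : probability Omega R.
Variables (X : ptopologicalType) (H : probability (borel X) R).
Variable Z : nat -> {RV P >-> borel X}.
Hypothesis Z_law : forall n (A : set (borel X)), measurable A ->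
     distribution P (Z n) A = H A.
Hypothesis Z_indep : mutually_independent Z.
Variable U : nat -> set X.
Hypothesis U_open : forall k, open (U k).
Hypothesis U_sep : forall x y, x <> y -> exists k, U k x /\ ~ U k y.

Variable n : nat.

Definition cylinders : set (set ('I_n -> borel X)) :=
  [set E | exists2 A : 'I_n -> set (borel X), (forall i, measurable (A i)) &
     E = [set z | forall i, A i (z i)]].

Lemma measurable_vector d' (W : measurableType d') (f : W -> 'I_n -> borel X) :
  (forall i, measurable_fun setT (fun w => f w i)) ->
  measurable_fun setT (f : W -> g_sigma_algebraType cylinders).
Proof.
move=> mf; apply: (@measurability _ _ W (g_sigma_algebraType cylinders) setT f cylinders) => //.
move=> _ [_ [A mA ->] <-]; rewrite setTI.
rewrite (_ : _ @^-1` _ = \bigcap_(i in [set: 'I_n]) ((fun w => f w i) @^-1` A i)).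
  apply: fin_bigcap_measurable => [|i _]; first exact: finite_finset.
  by rewrite -[X in measurable X]setTI; apply: mf.
by apply/seteqP; split => w /= h i; [move=> _; exact: h|exact: h].
Qed.

Lemma measurable_coordinate i :
  measurable_fun setT (fun z : g_sigma_algebraType cylinders => z i : borel X).
Proof.
move=> _ B mB; rewrite setTI; apply: sub_sigma_algebra.
exists (fun j => if j == i then B else setT) => [j|]; first by case: ifP.
apply/seteqP; split => z /=; last by move=> /(_ i); rewrite eqxx.
by move=> Bz j; case: eqP => [->|].
Qed.

Lemma measurable_kernel_partition p :
  measurable [set z : g_sigma_algebraType cylinders | kernel_partition z = p].
Proof.
have [pp|np] := boolP (is_partition p); last first.
  rewrite (_ : [set _ | _] = set0) ?measurable0//.
  by apply/seteqP; split => z //= e; move: np; rewrite -e kernel_partition_is.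
pose D i j := [set z : g_sigma_algebraType cylinders | z i = z j].
have mD i j : measurable (D i j).
  have := measurable_fun_pair (measurable_coordinate i) (measurable_coordinate j).
  move=> /(_ measurableT _ (measurable_diagonal U_open U_sep)).
  by rewrite setTI.
rewrite (_ : [set _ | _] = \bigcap_(ij in [set: 'I_n * 'I_n])
   (if ij.2 \in finset.pblock p ij.1 then D ij.1 ij.2 else ~` D ij.1 ij.2)).
  apply: fin_bigcap_measurable => [|ij _]; first exact: finite_finset.
  by case: ifP => _ //; apply: measurableC.
apply/seteqP; split => z /=.
  move/(kernel_partitionP _ pp) => h [i j] _ /=; rewrite -h.
  by case: eqP.
move=> h; apply/(kernel_partitionP _ pp) => i j; have := h (i, j) I => /=.
by case: ifP => _; rewrite /D /= => /eqP // /negbTE.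
Qed.

Let labels (u : 'I_n -> nat) (w : Omega) : g_sigma_algebraType cylinders := fun i => Z (u i) w.

Let labels_measurable u : measurable_fun setT (labels u).
Proof. by apply: measurable_vector => i; exact: measurable_funPT. Qed.

(** The coordinates that share an index are grouped together; the product runs
    over the first occurrences of the indices. *)
Lemma cylinder_prob (u : 'I_n -> nat) (A : 'I_n -> set (borel X)) :
  (forall i, measurable (A i)) ->
  P [set w | forall i, A i (Z (u i) w)] =
  (\prod_(i < n | [forall j : 'I_n, (j < i)%N ==> (u j != u i)])
     H (\bigcap_(j in [set j : 'I_n | u j = u i]) A j))%E.
Proof.
move=> mA; pose B k := \bigcap_(j in [set j : 'I_n | u j = k]) A j.
have mB k : measurable (B k).
  by apply: fin_bigcap_measurable => [|j _]; [exact: finite_finset|exact: mA].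
pose first (i : 'I_n) := [forall j : 'I_n, (j < i)%N ==> (u j != u i)].
pose s := [seq u i | i <- enum 'I_n & first i].
have firstP (i j : 'I_n) : first i -> (j < i)%N -> u j <> u i.
  by move=> /forallP /(_ j) /implyP h /h /eqP.
have us : uniq s.
  rewrite map_inj_in_uniq; first by apply: filter_uniq; exact: enum_uniq.
  move=> i j; rewrite !mem_filter => /andP[fi _] /andP[fj _] uij.
  apply: val_inj => /=; have [ij|ji|//] := ltngtP i j.
  - by case: (firstP _ _ fj ij).
  - by case: (firstP _ _ fi ji).
have s_u (i : 'I_n) : u i \in s.
  case: (@arg_minnP _ i (fun j => u j == u i) (fun j => j : nat)) => // k /eqP uk kmin.
  apply/mapP; exists k => //; rewrite mem_filter mem_enum andbT.
  apply/forallP => j; apply/implyP => jk; apply/eqP => uj.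
  by have := kmin j; rewrite uj uk eqxx leqNgt jk => /(_ isT).
have := Z_indep us mB.
rewrite (_ : \bigcap_(i in _) _ = [set w | forall i, A i (Z (u i) w)]).
  move=> ->; rewrite big_map big_filter big_enum_cond /=; apply: eq_bigr => i _.
  by rewrite (Z_prob Z_law).
apply/seteqP; split => w /=.
  by move=> h i; exact: (h (u i) (s_u i) i erefl).
by move=> h k _ j /= <-; exact: h.
Qed.

(** By [cylinder_prob] the two random vectors of labels give the same
    probability to every cylinder, and cylinders determine a law. *)
Lemma kernel_law (u v : 'I_n -> nat) p :
  (forall i j, (u i == u j) = (v i == v j)) ->
  P [set w | kernel_partition (fun i => Z (u i) w) = p] =
  P [set w | kernel_partition (fun i => Z (v i) w) = p].
Proof.
move=> uv.
pose Fu : {mfun Omega >-> g_sigma_algebraType cylinders} := mfun_Sub (mem_set (labels_measurable u)).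
pose Fv : {mfun Omega >-> g_sigma_algebraType cylinders} := mfun_Sub (mem_set (labels_measurable v)).
pose Ep := [set z : g_sigma_algebraType cylinders | kernel_partition z = p].
rewrite -[LHS]/(distribution P Fu Ep) -[RHS]/(distribution P Fv Ep).
apply: (@measure_unique _ R (g_sigma_algebraType cylinders) cylinders (fun=> setT) _ _ _ _
  (distribution P Fu) (distribution P Fv)) => //.
- move=> _ _ [A mA ->] [B mB ->]; exists (fun i => A i `&` B i) => [i|].
    exact: measurableI.
  by apply/seteqP; split => z /=; [move=> [a b] i; split|move=> h; split => i; have [] := h i].
- by move=> _; exists (fun=> setT) => [i //|]; apply/seteqP; split.
- by rewrite bigcup_const//; exists 0%N.
- move=> _ [A mA ->].
  rewrite /distribution /pushforward /=.
  transitivity (P [set w | forall i, A i (Z (u i) w)]); first by [].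
  rewrite cylinder_prob//.
  transitivity (P [set w | forall i, A i (Z (v i) w)]); last by [].
  rewrite cylinder_prob//.
  apply: eq_big => [i|i _]; first by apply: eq_forallb => j; rewrite uv.
  rewrite (_ : [set j | u j = u i] = [set j | v j = v i])//.
  by apply/seteqP; split => j /= /eqP e; apply/eqP; move: e; rewrite uv.
- by move=> _; apply: le_lt_trans (ltry 1); exact: (@probability_le1 _ _ _ (distribution P Fu)).
exact: measurable_kernel_partition.
Qed.

Lemma kernel_event_sigma (u : 'I_n -> nat) p :
  sigma_of_sequence Z [set w | kernel_partition (fun i => Z (u i) w) = p].
Proof.
pose G : set (set Omega) :=
  [set E | exists k (A : set (borel X)), measurable A /\ E = Z k @^-1` A].
have m : measurable_fun setT (labels u : g_sigma_algebraType G -> g_sigma_algebraType cylinders).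
  apply: measurable_vector => i _ B mB; rewrite setTI.
  by apply: sub_sigma_algebra; exists (u i), B.
by have := m measurableT _ (measurable_kernel_partition p); rewrite setTI.
Qed.

Lemma kernel_event_measurable (u : 'I_n -> nat) p :
  measurable [set w | kernel_partition (fun i => Z (u i) w) = p].
Proof.
by have := labels_measurable u measurableT (measurable_kernel_partition p); rewrite setTI.
Qed.
End ExchangeableLabels.

Section InducedExchangeable.
Context {d : measure_display} {Omega : measurableType d} {R : realType}.
Variable P : probability Omega R.
Variable Pi : forall n : nat, Omega -> {set {set 'I_n}}.
Hypothesis Pi_part : random_partition Pi.
Hypothesis Pi_exch : exchangeable P Pi.
Variables (X : ptopologicalType) (H : probability (borel X) R).
Variable Z : nat -> {RV P >-> borel X}.
Hypothesis Z_law : forall n (A : set (borel X)), measurable A ->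
     distribution P (Z n) A = H A.
Hypothesis Z_indep : mutually_independent Z.
Hypothesis Pi_Z_indep :
     independent_sigma P (sigma_of_partition Pi) (sigma_of_sequence Z).
Variable U : nat -> set X.
Hypothesis U_open : forall k, open (U k).
Hypothesis U_sep : forall x y, x <> y -> exists k, U k x /\ ~ U k y.

Let Pi_is n w : is_partition (Pi n w). Proof. by case: Pi_part. Qed.
Let Pi_restrict m n (mn : (m <= n)%N) w : restrict_partition mn (Pi n w) = Pi m w.
Proof. by case: Pi_part. Qed.
Let Pi_meas n p : measurable [set w | Pi n w = p]. Proof. by case: Pi_part. Qed.

Lemma induced_labelled n w :
  induced_partition n (labelled_sequence Pi Z w) =
  kernel_partition (fun i => Z (block_index (Pi n w) i) w).
Proof.
rewrite induced_kernel; apply: kernel_partition_eq => i j.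
have E k : labelled_sequence Pi Z w (nat_of_ord k) = Z (block_index (Pi n w) k) w.
  rewrite -(arrival_labelE (pi := fun m => Pi m w) (fun m => Pi_is m w)
    (fun m m' mm' => Pi_restrict mm' w)).
  by [].
by rewrite !E.
Qed.

Let split_event n p : [set w | induced_partition n (labelled_sequence Pi Z w) = p] =
  \big[setU/set0]_(pi : {set {set 'I_n}}) ([set w | Pi n w = pi] `&`
    [set w | kernel_partition (fun i => Z (block_index pi i) w) = p]).
Proof.
apply/seteqP; split => w /=.
  rewrite induced_labelled => e; rewrite (bigD1 (Pi n w))//=; left; split => //.
rewrite -bigcup_seq/= => -[pi _ [/= <-]].
by rewrite induced_labelled.
Qed.

Lemma induced_labelled_measurable n p :
  measurable [set w | induced_partition n (labelled_sequence Pi Z w) = p].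
Proof.
rewrite split_event; apply: bigsetU_measurable => pi _; apply: measurableI; first exact: Pi_meas.
exact: (kernel_event_measurable Z U_open U_sep).
Qed.

Let induced_labelled_prob n p :
  P [set w | induced_partition n (labelled_sequence Pi Z w) = p] =
  (\sum_(pi : {set {set 'I_n}}) P [set w | Pi n w = pi] *
    P [set w | kernel_partition (fun i => Z (block_index pi i) w) = p])%E.
Proof.
rewrite split_event measure_big_disjoint.
- apply: eq_bigr => pi _; apply: Pi_Z_indep.
    by apply: sub_sigma_algebra; exists n, pi.
  exact: (kernel_event_sigma U_open U_sep).
- exact: index_enum_uniq.
- move=> pi; apply: measurableI; first exact: Pi_meas.
  exact: (kernel_event_measurable Z U_open U_sep).
- move=> pi pi' /eqP pp'; apply/seteqP; split => // w [[/= e _] [/= e' _]].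
  by apply: pp'; rewrite -e.
Qed.

(** The partition s Pi_n is as likely as Pi_n.  Its blocks are indexed in another
    order, but two elements have the same block index in Pi_n exactly when their
    images by s have the same one in s Pi_n, and [kernel_law] applies. *)
Lemma induced_labelled_exchangeable :
  exchangeable P (fun n w => induced_partition n (labelled_sequence Pi Z w)).
Proof.
move=> n s p; rewrite !induced_labelled_prob.
rewrite (reindex (@perm_partition n s)) /=; last exact/onW_bij/perm_partition_bij.
apply: eq_bigr => pi _; rewrite Pi_exch.
have [pp|np] := boolP (is_partition pi); last first.
  rewrite (_ : [set w | Pi n w = pi] = set0) ?measure0 ?mul0e//.
  by apply/seteqP; split => w //= e; move: np; rewrite -e Pi_is.
congr (_ * _)%E.
rewrite -[RHS](kernel_law Z_law Z_indep U_open U_sep (u := fun i => block_index (perm_partition s pi) (s i))); last first.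
  by move=> i j; rewrite block_index_perm.
congr (P _); apply/seteqP; split => w /=.
  by rewrite -(kernel_partition_perm _ s) => /(bij_inj (perm_partition_bij s)).
by move=> <-; rewrite (kernel_partition_perm (fun i => Z (block_index (perm_partition s pi) i) w)).
Qed.
End InducedExchangeable.

(** * The number of blocks of a given size *)

Theorem theorem10 (R : realType) (d : measure_display)
  (Omega : measurableType d) (P : probability Omega R)
  (* the exchangeable random partition and its EPPF *)
  (Pi : forall n : nat, Omega -> {set {set 'I_n}}) (q : seq nat -> R)
  (Pi_part : random_partition Pi)
  (Pi_exch : exchangeable P Pi)
  (Pi_eppf : is_EPPF P Pi q)
  (Pi_freq : proper_frequencies P Pi)
  (* the i.i.d. labels *)
  (X : ptopologicalType) (X_polish : polish R X)
  (H : probability (borel X) R)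
  (Z : nat -> {RV P >-> borel X})
  (Z_law : forall n (A : set (borel X)), measurable A ->
     distribution P (Z n) A = H A)
  (Z_indep : mutually_independent Z)
  (Pi_Z_indep :
     independent_sigma P (sigma_of_partition Pi) (sigma_of_sequence Z))
  (H_atoms : 0 < atomic_mass H)
  (* asymptotics of the number of blocks *)
  (S : {RV P >-> R}) (S_gt0 : {ae P, forall w, 0 < S w})
  (sigma : R) (sigma_gt0 : 0 < sigma) (sigma_lt1 : sigma < 1)
  (l : R -> R) (l_sv : slowly_varying l)
  (Pi_blocks : {ae P, forall w,
     #|Pi n w|%:R / (n%:R `^ sigma * l n%:R) @[n --> \oo] --> S w})
  (* asymptotics of the atoms of H *)
  (sigma0 : R) (sigma0_ge0 : 0 <= sigma0) (sigma0_le1 : sigma0 <= 1)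
  (l0 : R -> R) (l0_sv : slowly_varying l0)
  (alphaE : forall x : R, 0 < x ->
     (atom_count H x)%:R = x `^ sigma0 * l0 x)
  (l0_cvg : sigma0 = 0 -> l0 x @[x --> +oo] --> +oo)
  (a_lt1 : atomic_mass H < 1)
  (r : nat) (r_ge1 : (1 <= r)%N) :
  {ae P, forall w,
    (num_blocks_of_size r
       (induced_partition n (labelled_sequence Pi Z w)))%:R
      / (n%:R `^ sigma * l n%:R) @[n --> \oo]
    --> (1 - atomic_mass H) * S w *
        (sigma * Gamma (r%:R - sigma) / (Gamma (1 - sigma) * (r`!)%:R))}.
Proof.
have [U [U_open U_sep]] := polish_separating X_polish.
have sigma01 : 0 < sigma < 1 by rewrite sigma_gt0.
pose x w := labelled_sequence Pi Z w.
pose Kt n w : R := #|induced_partition n (x w)|%:R.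
have [Pi_is Pi_res _] := Pi_part.
(* the blocks of the merged partition correspond to the distinct values among
   the first #|Pi n w| labels *)
have Kt_ratio : {ae P, forall w, Kt n w / (n%:R `^ sigma * l n%:R) @[n --> \oo]
    --> (1 - atomic_mass H) * S w}.
  have D := distinct_values_ratio Z_law Z_indep U_open U_sep.
  move: S_gt0 Pi_blocks D; apply: filterS3 => w Sw Kw Dw.
  pose c := arrival_label (fun n => Pi n w).
  have Pi_w n : Pi n w = induced_partition n c.
    by apply: (@consistent_induced (fun n => Pi n w)) => // m m' mm'; exact: Pi_res.
  have reg : regular_at (fun n => #|induced_partition n c|%:R) sigma.
    apply: (regular_of_slowly_varying l_sv Sw).
    by under eq_fun do rewrite -Pi_w.
  have Koo := regular_infty sigma_gt0 reg.
  have DK := cvg_comp _ _ Koo Dw.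
  apply: (eq_near_cvg _ (cvgM DK Kw)); near=> n.
  rewrite /= -Pi_w /Kt.
  have -> : #|induced_partition n (x w)| = #|induced_partition #|Pi n w| (fun i => Z i w)|.
    by apply: (@card_induced_relabel (fun n => Pi n w)) => // m m' mm'; exact: Pi_res.
  rewrite mulrA divfK//.
  rewrite Pi_w pnatr_eq0 -lt0n card_induced_partition_gt0//.
  by near: n; exact: nbhs_infty_gt.
have ratio := exchangeable_block_size_ratio sigma01
  (induced_labelled_measurable Pi_part Z U_open U_sep)
  (induced_labelled_exchangeable Pi_part Pi_exch Z_law Z_indep Pi_Z_indep U_open U_sep).
have reg : {ae P, forall w, regular_at (fun n => Kt n w) sigma}.
  move: S_gt0 Kt_ratio; apply: filterS2 => w Sw Kw.
  by apply: (regular_of_slowly_varying l_sv _ Kw); rewrite mulr_gt0// subr_gt0.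
move: (ratio reg r r_ge1) Kt_ratio; apply: filterS2 => w rw Kw.
rewrite -Gamma_binom_coef// [X in _ --> X]mulrC.
apply: (eq_near_cvg _ (cvgM rw Kw)); near=> n.
rewrite /= mulrA divfK// pnatr_eq0 -lt0n card_induced_partition_gt0//.
by near: n; exact: nbhs_infty_gt.
Unshelve. all: by end_near. Qed.
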